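(* The following statements hold: (1) For each finite group $G$, the following are equivalent: (a) $\operatorname{maol}(G)\leqslant 3$. (b) $G$ is isomorphic to one of the following: $\mathbb{Z}/m\mathbb{Z}$ with $m\in\{1,2,3,4,6\}$, $(\mathbb{Z}/2\mathbb{Z})^2$, $\operatorname{Sym}(3)$. In particular, there are only finitely many finite groups $G$ (up to isomorphism) with $\operatorname{maol}(G)\leqslant 3$. (2) There are infinitely many finite $2$-groups $G$ (up to isomorphism) with $\operatorname{maol}(G)=8$. (3) For each pair $(c,d)$ of positive integers and every $d$-generated finite group $G$ with $\operatorname{maol}(G)\leqslant c$, we have \[ \log|G|\leqslant 1.01624\,d\cdot\left(A(c,d)+1\right)\cdot\left(\frac{\log A(c,d)}{\log 2}+1\right)+\frac{1}{2}(7+\log c)\log c, \] where \[ A(c,d):=c^{\,d+\frac{1}{2}(7+\log c)\left(\binom{d}{2}+\frac{d}{2\log 2}\cdot(7+\log c)\log c\right)}. \] (4) Every finite group $G$ with $\operatorname{maol}(G)\leqslant 23$ is solvable.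
   Context: For a finite group $G$, $\operatorname{maol}(G)$ denotes the maximum length of an orbit of the natural action of the automorphism group $\operatorname{Aut}(G)$ on $G$. The symbol $\log$ denotes the natural logarithm. A finite group is $d$-generated if it has a generating subset with at most $d$ elements. $\operatorname{Sym}(3)$ is the symmetric group of degree $3$. *)

(* Defs.v *)
From HB Require Import structures.
From mathcomp Require Import all_boot all_order all_algebra.
From mathcomp Require Import all_fingroup all_solvable.
From mathcomp Require Import reals exp.

Set Implicit Arguments.
Unset Strict Implicit.
Unset Printing Implicit Defensive.

Import GRing.Theory.

Local Open Scope ring_scope.

Definition maol (gT : finGroupType) (G : {group gT}) : nat :=
  (\max_(x in G) #|orbit 'P%act (Aut G) x|)%N.

Definition d_generated (d : nat) (gT : finGroupType) (G : {group gT}) : Prop :=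
  exists2 S : {set gT}, (#|S| <= d)%N & <<S>>%g = G.

(* The groups satisfying P lie in finitely many isomorphism classes; the
   groups may live in different ambient finGroupTypes. *)
Definition finitely_many_up_to_isog
    (P : forall gT : finGroupType, {group gT} -> Prop) : Prop :=
  exists (n : nat) (hT : 'I_n -> finGroupType) (H : forall i, {group hT i}),
    forall (gT : finGroupType) (G : {group gT}),
      P gT G -> exists i : 'I_n, G \isog H i.

Definition infinitely_many_up_to_isog
    (P : forall gT : finGroupType, {group gT} -> Prop) : Prop :=
  ~ finitely_many_up_to_isog P.

Definition Abound (R : realType) (c d : nat) : R :=
  c%:R `^ (d%:R + 2^-1 * (7 + ln c%:R) *
    ('C(d, 2)%:R + d%:R / (2 * ln 2) * ((7 + ln c%:R) * ln c%:R))).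

(* Main.v *)
Require Import Defs.
From HB Require Import structures.
From mathcomp Require Import all_boot all_order all_algebra.
From mathcomp Require Import all_fingroup all_solvable all_character.
From mathcomp Require Import zify ring lra.
From mathcomp Require Import reals exp.

Set Implicit Arguments.
Unset Strict Implicit.
Unset Printing Implicit Defensive.

Import GRing.Theory.

Local Open Scope ring_scope.

(** Orbits of Aut(G) contain conjugacy classes, so maol(G) bounds all class
    sizes, and explicit automorphisms bound everything else.

    (1) If a centralizer of index 3 is not normal, G acts on its three
    conjugates, and this forces G = Sym(3). Otherwise a nonabelian G has class
    two, and [mem_Aut_orbit_ext] gives an outer automorphism with a longer orbit.

    (2) The groups are class-two extensions of V = F_2^(m+3) x F_2^(m+2) by
    W = F_2^3 whose commutator form is a Kronecker pencil. The pencil has exactly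
    three vectors of rank one, with pairwise different squares, hence fixed by
    every automorphism; propagating along the pencil, every automorphism is
    trivial on V. The orbits of maximal length are the cosets of W.

    (3) G/Z(G) has order n <= c^d. Composing the transfer G -> Z(G) with powers
    gives automorphisms raising central elements to powers congruent to 1 mod n,
    which bounds their orders; Schreier's generators then bound |Z(G)|. This
    bound on |G| is far below the stated one.

    (4) A simple group with class sizes at most 23 has order 60, by Burnside's
    prime power theorem and Sylow counting. The last derived subgroup M of a
    nonsolvable G is such a simple group, and G embeds in Sym(5) x G/M by its
    action on the five Sylow 2-subgroups of M. Conjugation by Sym(5) normalizes
    the image, so an element of order 5 of M has an orbit of length 24. *)

(** In (2) one factor of V is one dimension larger than the other, so V has odd dimension and each
    of the three nonzero combinations of the two alternating forms is degenerate; its radical is a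
    line, and these three lines are the rank one vectors. In (3) the obstacle is the exponent of
    Z(G), which class sizes do not see. The automorphisms only give exponents congruent to 1 modulo
    n, so the units modulo the order of a central element are cut into at most n residue classes,
    each contributing at most c; the order is then recovered from its totient. In (4) the number 24
    counts the elements of order 5 in Alt(5): they form two classes of length 12, which Sym(5)
    fuses. The bound 23 leaves 15 and 21 as the only odd sizes of nontrivial classes in a nonabelian
    simple group, and every proper multiple of these exceeds 23. This rigidity makes both the odd
    order theorem and classification results dispensable, and it lets commutation relations be
    lifted from a simple quotient. *)

Section Totient.

Local Open Scope nat_scope.

(** Bounds an order by the number of generators of the cyclic group, which is what orbits control in
    (1) and (3). The totient is multiplicative, and 2 is the only prime power exceeding the square
    of its totient. *)
Lemma leq_totient_sqr n : 0 < n -> n <= 2 * totient n ^ 2.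
Proof.
(* The factor 2 is spent at most once, so the induction grants it to even [n] only. *)
suff: 0 < n -> n <= 2 ^ (~~ odd n) * totient n ^ 2.
  move=> le_n /le_n {le_n}le_n; apply: leq_trans le_n _.
  by rewrite leq_mul2r; case: (odd n); rewrite orbT.
elim/ltn_ind: n => n IHn n_gt0; case: (leqP n 1) => [n_le1 | n_gt1].
  by have -> : n = 1 by apply/eqP; rewrite eqn_leq n_le1.
pose p := pdiv n; have p_pr : prime p := pdiv_prime n_gt1.
have p_gt1 := prime_gt1 p_pr.
have [m co_pm def_n] := pfactor_coprime p_pr n_gt0.
have : 0 < logn p n by rewrite logn_gt0 mem_primes p_pr n_gt0 pdiv_dvd.
case: (logn p n) def_n => // e def_n _.
have m_gt0 : 0 < m by move: n_gt0; rewrite def_n muln_gt0 => /andP[].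
have le_m : m <= 2 ^ (~~ odd m) * totient m ^ 2.
  by apply: IHn => //; rewrite def_n ltn_Pmulr // -(expn0 p) ltn_exp2l.
have -> : totient n = totient m * (p.-1 * p ^ e).
  by rewrite def_n totient_coprime ?coprimeXr 1?coprime_sym // totient_pfactor.
have [p2 | p_odd] := even_prime p_pr.
  have m_odd : odd m by rewrite p2 coprime2n in co_pm.
  rewrite m_odd in le_m; rewrite def_n p2 oddM oddX m_odd /= !mul1n !expnMn.
  rewrite mul1n in le_m.
  by rewrite mulnCA leq_mul // expnS leq_mul // -expnM leq_exp2l // leq_pmulr.
have le_pe : p ^ e.+1 <= (p.-1 * p ^ e) ^ 2.
  rewrite expnMn -expnM expnS leq_mul ?leq_exp2l // ?leq_pmulr //.
  move: p_odd p_gt1; case: (p) => [|[|[|q]]] //= _ _.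
  by rewrite /= -[q.+3]add1n -[q.+2 ^ 2]/(q.+2 * q.+2); nia.
have -> : odd n = odd m by rewrite def_n oddM oddX p_odd orbT andbT.
by rewrite def_n expnMn mulnA leq_mul.
Qed.

End Totient.

(** * Automorphism orbits, transfer, permutation representations *)

Section Common.

Local Open Scope nat_scope.
Local Open Scope group_scope.

Lemma maol_leqP (gT : finGroupType) (G : {group gT}) (c : nat) :
  reflect {in G, forall x, #|orbit 'P%act (Aut G) x| <= c} (maol G <= c).
Proof. exact: bigmax_leqP. Qed.

Lemma mem_Aut_orbit (gT : finGroupType) (G : {group gT})
    (f : {morphism G >-> gT}) (x : gT) :
  'injm f -> f @* G = G -> x \in G -> f x \in orbit 'P%act (Aut G) x.
Proof.
move=> injf fG Gx; apply/orbitP; exists (aut injf fG); first exact: Aut_aut.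
by rewrite /= /aperm autE.
Qed.

Lemma class_sub_Aut_orbit (gT : finGroupType) (G : {group gT}) (x : gT) :
  x \in G -> x ^: G \subset orbit 'P%act (Aut G) x.
Proof.
move=> Gx; apply/subsetP=> _ /imsetP[g Gg ->].
rewrite -(conjgmE G); apply: mem_Aut_orbit => //; first exact: injm_conj.
exact: norm_conjg_im (subsetP (normG G) _ Gg).
Qed.

Lemma index_cent1_maol (gT : finGroupType) (G : {group gT}) (c : nat) (x : gT) :
  maol G <= c -> x \in G -> #|G : 'C_G[x]| <= c.
Proof.
move=> /maol_leqP Gc Gx; rewrite index_cent1; apply: leq_trans (Gc x Gx).
exact/subset_leq_card/class_sub_Aut_orbit.
Qed.

(** The transfer of [x] is a product of conjugates of powers of [x] lying in [H], one for each cycle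
    of [x] on the cosets. If no power is fused to another element of [H], each conjugate is the
    power itself and the exponents add up to the index. Applied with [H] the center and with [H] an
    abelian Sylow subgroup. *)
Lemma transfer_expg (gT : finGroupType) (G H : {group gT}) :
  H \subset G -> abelian H ->
  exists f : {morphism G >-> gT}, f @* G \subset H /\
    {in H, forall x,
       (forall k g, g \in G -> (x ^+ k) ^ g \in H -> (x ^+ k) ^ g = x ^+ k) ->
       f x = x ^+ #|G : H|}.
Proof.
move=> sHG abH.
have abA : abelian (idm H @* H) by rewrite im_idm.
pose V := transfer G abA.
have fM : {in G &, {morph (fun g => FiniteModule.fmval (V g)) : x y / x * y}}.
  by move=> x y Gx Gy; rewrite /V transferM // FiniteModule.fmvalA.
exists (Morphism fM); split.
  apply/subsetP=> _ /morphimP[x Gx _ ->] /=.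
  by have := FiniteModule.fmodP (V x); rewrite /= im_idm.
move=> x Hx fus /=; have Gx := subsetP sHG x Hx.
have trX := transversalP (rcosets_cycle_partition sHG Gx).
rewrite /V (transfer_cycle_expansion sHG abA Gx trX).
set X := transversal _ _ in trX *.
have sXG : {subset X <= G} by apply/subsetP/(transversal_sub trX).
rewrite -(sum_index_rcosets_cycle sHG Gx trX).
rewrite (big_morph (@FiniteModule.fmval _ _ _) (@FiniteModule.fmvalA _ _ abA) (FiniteModule.fmval0 _)).
rewrite -prodgXr; apply: eq_bigr => y Xy.
rewrite /restrm /=.
have Hxy : (x ^+ #|<[x]> : H :* y|) ^ y^-1 \in H.
  rewrite conjgE invgK.
  have := mulg_exp_card_rcosets H x y; rewrite mem_rcoset. 
  by rewrite -mulgA.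
rewrite fus ?groupV ?sXG //.
have Hxn : x ^+ #|<[x]> : H :* y| \in H by apply: groupX.
by rewrite FiniteModule.fmodK //= ?im_idm // mem_morphim.
Qed.

Lemma action_perm (aT : finGroupType) (D G : {group aT}) (T : finType)
    (to : action D T) (S : {set T}) (n : nat) :
  G \subset D -> [acts G, on S | to] -> #|S| = n ->
  exists (f : {morphism G >-> 'S_n}) (e : 'I_n -> T),
    [/\ injective e, e @: [set: 'I_n] = S
       & {in G, forall g i, e (f g i) = to (e i) g}].
Proof.
move=> sGD actG <-.
have Sg (i : 'I_#|S|) g : g \in G -> to (enum_val i) g \in S.
  by move=> Gg; rewrite (acts_act actG) // enum_valP.
pose F g (i : 'I_#|S|) := enum_rank_in (enum_valP i) (to (enum_val i) g).
have FE g i : g \in G -> enum_val (F g i) = to (enum_val i) g.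
  by move=> Gg; rewrite enum_rankK_in ?Sg.
have injF g : g \in G -> injective (F g).
  move=> Gg i j /(congr1 enum_val); rewrite !FE // => /(act_inj to g).
  exact: enum_val_inj.
(* The identity is the default outside [G], since [perm] asks for an injection at every [g]. *)
have injF' g : injective (fun i => if g \in G then F g i else i).
  by move=> i j; case: (boolP (g \in G)) => [Gg /(injF g Gg) | _].
pose f g : 'S_#|S| := perm (@injF' g).
have fE g i : g \in G -> f g i = F g i by move=> Gg; rewrite /f permE Gg.
have fM : {in G &, {morph f : g h / g * h}}.
  move=> g h Gg Gh; apply/permP=> i; rewrite permM !fE ?groupM //.
  by apply: enum_val_inj; rewrite !FE ?groupM // actMin ?(subsetP sGD).
exists (Morphism fM), (@enum_val _ (mem S)); split=> [||g Gg i]; first exact: enum_val_inj.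
  apply/setP=> y; apply/imsetP/idP => [[i _ ->] | Sy]; first exact: enum_valP.
  by exists (enum_rank_in Sy y); rewrite ?enum_rankK_in.
by rewrite /= fE ?FE.
Qed.

Lemma morphim_class_inj (gT rT : finGroupType) (G : {group gT})
    (f : {morphism G >-> rT}) (x : gT) :
  x \in G -> #|x ^: G| <= #|f x ^: (f @* G)| -> {in x ^: G &, injective f}.
Proof.
move=> Gx le_cl; apply/imset_injP; rewrite eqn_leq leq_imset_card.
suff -> : f @: (x ^: G) = f x ^: (f @* G) by [].
by rewrite -morphimEsub ?morphim_class // class_subG.
Qed.

(** When the class of [x] does not shrink, [f] is injective on it, so [x ^ h = x] can be tested on
    images. This pulls information back from Sym(3) and from the simple quotient of a perfect
    group. *)
Lemma commute_lift (gT rT : finGroupType) (G : {group gT})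
    (f : {morphism G >-> rT}) (x h : gT) :
  x \in G -> h \in G -> #|x ^: G| <= #|f x ^: (f @* G)| ->
  commute (f x) (f h) -> commute x h.
Proof.
move=> Gx Gh /(morphim_class_inj Gx) injf cfxh; apply/commgP/conjg_fixP.
apply: injf; rewrite ?class_refl ?memJ_class ?imset_f //.
by rewrite morphJ //; apply/conjg_fixP/commgP.
Qed.

End Common.

(** * Orbits of length at most 3 *)

Section SmallOrbits.

Local Open Scope nat_scope.
Local Open Scope group_scope.

Lemma normal_prime_index_gen (gT : finGroupType) (G K : {group gT}) (x : gT) :
  K <| G -> prime #|G : K| -> x \in G -> x \notin K -> K * <[x]> = G.
Proof.
move=> /andP[sKG nKG] p_pr Gx Kx.
have nKx : <[x]> \subset 'N(K) by rewrite cycle_subG (subsetP nKG).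
rewrite -norm_joinEr //; apply/eqP; rewrite eqEsubset join_subG sKG cycle_subG Gx /=.
rewrite -indexg_eq1.
have /primeP[_] := p_pr; move/(_ #|G : K <*> <[x]>|).
have sKKx : K \subset K <*> <[x]> by exact: joing_subl.
have sKxG : K <*> <[x]> \subset G by rewrite join_subG sKG cycle_subG.
rewrite -(Lagrange_index sKxG sKKx) dvdn_mulr // => /(_ isT)/orP[//|].
rewrite -{1}[X in X == _]muln1 eqn_pmul2l ?indexg_gt0 // eq_sym indexg_eq1.
by rewrite join_subG subxx cycle_subG (negPf Kx).
Qed.

(* The automorphism extends [f] by sending [x] to [y]. *)
Lemma mem_Aut_orbit_ext (gT : finGroupType) (G K : {group gT})
    (f : {morphism K >-> gT}) (x y : gT) :
  K <| G -> prime #|G : K| -> f @* K = K -> x \in G -> x \notin K ->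
  y \in K :* x -> {in K, forall k, f (k ^ x) = f k ^ y} ->
  f (x ^+ #|G : K|) = y ^+ #|G : K| -> y \in orbit 'P%act (Aut G) x.
Proof.
move=> nsKG p_pr fK Gx Kx Kxy fJ; set p := #|G : K| in p_pr * => fx.
have [sKG nKG] := andP nsKG; have nKx := subsetP nKG x Gx.
have oKx : #[coset K x] = p.
  have: #[coset K x] %| p by rewrite /p -card_quotient // order_dvdG ?mem_quotient.
  case/primeP: p_pr => _ /[apply] /pred2P[/eqP|//].
  by rewrite order_eq1 => /eqP/coset_idr; rewrite (negPf Kx) => /(_ nKx).
have xK j : x ^+ j \in K -> p %| j.
  by move=> Kxj; rewrite -oKx order_dvdn -morphX //= coset_id.
have Gy : y \in G by have /rcosetP[k Kk ->] := Kxy; rewrite groupM // (subsetP sKG).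
have nKy : y \in 'N(K) by exact: subsetP nKG y Gy.
have Kxp : x ^+ p \in K by apply: coset_idr; rewrite ?groupX // morphX //= -oKx expg_order.
(* As [y ^+ p] is the [f]-image of [x ^+ p], raising [y] to the order of [x] gives 1; hence [x] may
   be sent to [y] on the cycle. *)
have dvd_yx : #[y] %| #[x].
  have /dvdnP[n def_x] : p %| #[x] by rewrite -oKx morph_order.
  rewrite order_dvdn def_x mulnC expgM -fx -morphX // -expgM mulnC -def_x.
  by rewrite expg_order morph1.
have nKX : <[x]> \subset 'N(K) by rewrite cycle_subG.
have actf : {in K & <[x]>, morph_act 'J 'J f (eltm dvd_yx)}.
  move=> k _ Kk /cycleP[j ->] /=; rewrite eltmE.
  elim: j k Kk => [|j IHj] k Kk; first by rewrite !conjg1.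
  by rewrite !expgS !conjgM IHj ?memJ_norm // fJ.
(* An element of [K] in the cycle is a power of [x ^+ p], where both maps agree by hypothesis. *)
have eqf : {in K :&: <[x]>, f =1 eltm dvd_yx}.
  move=> w /setIP[Kw /cycleP[j wE]]; rewrite {w}wE in Kw *.
  have /dvdnP[n ->] := xK j Kw; rewrite eltmE.
  by rewrite mulnC !expgM morphX // fx.
have Ky : y \notin K by have /rcosetP[k Kk ->] := Kxy; rewrite groupMl.
have defG : (K <*> <[x]>)%G = G.
  by apply/val_inj; rewrite /= norm_joinEr // (@normal_prime_index_gen _ G).
pose h := pprodm_morphism nKX actf eqf.
have hG : h @* (K <*> <[x]>) = K <*> <[x]>.
  rewrite [X in h @* X]norm_joinEr // morphim_pprodm // fK /= im_eltm.
  by rewrite (@normal_prime_index_gen _ G) //; apply: esym (congr1 val defG).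
have injh : 'injm h by rewrite -card_im_injm hG.
have hx : h x = y by rewrite /= pprodmEr ?cycle_id //=; apply: eltm_id.
have : h x \in orbit 'P (Aut (K <*> <[x]>)) x.
  by apply: mem_Aut_orbit; rewrite //= mem_gen // inE cycle_id orbT.
by rewrite hx (_ : K <*> <[x]> = G) //; apply: (congr1 val defG).
Qed.

(** The endomorphism fixing [H] and sending [x] to [x ^+ k * y] exists because the exponent of [H]
    divides the order of [x], and it is onto because [x ^+ k] still generates the cycle. *)
Lemma dprod_cycle_orbit (gT : finGroupType) (G H : {group gT}) (x y : gT) (k : nat) :
  abelian G -> <[x]> \x H = G -> exponent H %| #[x] -> coprime k #[x] -> y \in H ->
  x ^+ k * y \in orbit 'P%act (Aut G) x.
Proof.
move=> abG defG expH co_kx Hy.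
have [_ defG' cXH _] := dprodP defG.
have Gx : x \in G by rewrite -defG' (subsetP (mulG_subl _ _)) ?cycle_id.
have sHG : H \subset G by rewrite -defG' mulG_subr.
have sHGy : y \in G by apply: (subsetP sHG).
have cxy : commute (x ^+ k) y by apply: (centsP abG); rewrite ?groupX.
have dvd_ord : #[x ^+ k * y] %| #[x].
  rewrite order_dvdn expgMn // -expgM mulnC expgM expg_order expg1n mul1g.
  by rewrite -order_dvdn (dvdn_trans _ expH) // dvdn_exponent.
have cf : idm H @* H \subset 'C(eltm dvd_ord @* <[x]>).
  rewrite im_idm /= im_eltm (sub_abelian_cent2 abG) // cycle_subG.
  by rewrite groupM ?groupX ?sHGy.
pose f := dprodm_morphism defG cf.
have fG : f @* G = G.
  have -> : f @* G = <[x ^+ k * y]> <*> H.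
    transitivity (f @* (<[x]> * H)); first by rewrite defG'.
    rewrite morphim_dprodm // im_idm /= im_eltm -norm_joinEr //.
    by rewrite cents_norm // (sub_abelian_cent2 abG) // cycle_subG groupM ?groupX ?sHGy.
  apply/eqP; rewrite eqEsubset join_subG sHG andbT cycle_subG.
  rewrite groupM ?groupX ?sHGy //= -[in X in X \subset _]defG'.
  rewrite mul_subG ?joing_subr //.
  have /eqP-> : generator <[x]> (x ^+ k) by rewrite generator_coprime coprime_sym.
  rewrite cycle_subG -[X in X \in _](mulgK y) groupM ?groupV //.
    by rewrite -cycle_subG joing_subl.
  by rewrite (subsetP (joing_subr _ _)).
have injf : 'injm f by rewrite -card_im_injm fG.
have <- : f x = x ^+ k * y.
  by rewrite /= dprodmEl ?cycle_id //=; apply: eltm_id.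
exact: mem_Aut_orbit.
Qed.

Lemma totient_leq3 n : 0 < n -> totient n <= 3 -> n \in [:: 1; 2; 3; 4; 6]%N.
Proof.
move=> n_gt0 phi_n; have : n <= 18.
  apply: leq_trans (leq_totient_sqr n_gt0) _.
  by rewrite (@leq_mul 2 _ 2 9) // (@leq_exp2r _ 3 2).
move: phi_n n_gt0; do 19?[case: n => [|n] //].
Qed.

(** A cyclic factor of order the exponent splits off. The orbit of its generator [x] contains all
    products of a generator of [<[x]>] with an element of the complement [H], so both the totient of
    the order and [#|H|] are small. *)
Lemma abelian_maol_leq3 (gT : finGroupType) (G : {group gT}) :
  abelian G -> maol G <= 3 ->
  (exists2 m : nat, m \in [:: 1; 2; 3; 4; 6]%N & G \isog Zp m)
    \/ G \isog [set: 'Z_2 * 'Z_2].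
Proof.
move=> abG /maol_leqP maolG.
have [x Gx expG] := exponent_witness (abelian_nil abG).
have /splitsP[H /complP[tiXH defG']] := abelian_splits Gx (esym expG) abG.
have sHG : H \subset G by rewrite -defG' mulG_subr.
have defG : <[x]> \x H = G.
  by rewrite dprodE // (sub_abelian_cent2 abG) // cycle_subG.
have expH : exponent H %| #[x] by rewrite -expG exponentS.
have orb k y : coprime k #[x] -> y \in H -> x ^+ k * y \in orbit 'P%act (Aut G) x.
  exact: dprod_cycle_orbit.
have orb1 y : y \in H -> x * y \in orbit 'P%act (Aut G) x.
  by move=> Hy; have := orb 1%N y (coprime1n _) Hy; rewrite expg1.
have [n3 | n2] := leqP 3 #[x].
  have H1 : H :=: 1.
    apply/eqP; rewrite -subG1; apply/subsetP=> y Hy; rewrite inE; apply/idPn=> nt_y.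
    have := maolG x Gx; apply/negP; rewrite -ltnNge.
    (* [x ^+ k] is the inverse of [x] and differs from [x], so a nontrivial [y] puts four elements
       into the orbit. *)
    pose k := #[x].-1; have co_k : coprime k #[x] by rewrite /k -{2}(prednK (order_gt0 x)) coprimenS.
    have x_neq : x ^+ k != x.
      apply: contraTneq n3 => xk; rewrite -leqNgt -ltnS -[3]/(2.+1) ltnS dvdn_leq // order_dvdn.
      by rewrite expgS expg1 -{1}xk -expgSr /k prednK ?order_gt0 // expg_order.
    have inj_mul a b u v : a \in <[x]> -> b \in <[x]> -> u \in H -> v \in H ->
        (a * u == b * v) = (a == b) && (u == v).
      move=> Xa Xb Hu Hv; apply/eqP/andP=> [eq_au | [/eqP-> /eqP-> //]].
      have bau : b^-1 * a = v * u^-1 by apply: (canRL (mulgK _)); rewrite -mulgA eq_au mulKg.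
      have : b^-1 * a \in <[x]> :&: H.
        by rewrite inE groupM ?groupV //= bau groupM ?groupV.
      rewrite tiXH inE => /eqP ba1; split; first by rewrite eq_sym eq_mulVg1 ba1.
      by rewrite eq_sym eq_mulgV1 -bau ba1.
    have uniq4 : uniq [:: x * 1; x * y; x ^+ k * 1; x ^+ k * y].
      by rewrite /= !inE !inj_mul ?group1 ?groupX ?cycle_id // !eqxx
                 ![_ == x ^+ k]eq_sym (negPf x_neq) ![1 == _]eq_sym (negPf nt_y).
    have /= <- := card_uniqP uniq4; apply/subset_leq_card/subsetP=> z.
    rewrite !inE.
    by case/or4P=> /eqP->; [apply: orb1 | apply: orb1 | apply: orb | apply: orb].
  left; exists #[x]; last first.
    by rewrite -defG' H1 mulg1 isog_sym Zp_isog.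
  apply: totient_leq3; rewrite ?order_gt0 //; apply: leq_trans (maolG x Gx).
  rewrite totient_gen; apply/subset_leq_card/subsetP=> y.
  rewrite !inE => /eqP genxy.
  have /cycleP[k yE] : y \in <[x]> by rewrite genxy cycle_id.
  have co_kx : coprime k #[x] by rewrite coprime_sym -generator_coprime -yE; apply/eqP.
  by rewrite yE -[X in X \in _]mulg1; apply: orb.
have abel2 : exponent G %| 2 by move: (order_gt0 x) n2; rewrite expG; case: #[x] => [|[|[|]]].
have cH : #|H| <= 3.
  rewrite -(card_imset H (mulgI x)); apply: leq_trans (maolG x Gx).
  apply/subset_leq_card/subsetP=> _ /imsetP[y Hy ->].
  exact: orb1.
have abelG : 2.-abelem G by rewrite abelemE // abG.
have pH : 2.-group H by apply: pgroupS sHG (abelem_pgroup abelG).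
have cardG : #|G| = (#[x] * #|H|)%N by rewrite -defG' TI_cardMg.
have := card_pgroup pH; case: (logn 2 #|H|) => [|[|e]] cardH; last first.
  by move: cH; rewrite cardH leqNgt (@leq_exp2l 2 2).
  have dvd2H : 2 %| #|H| by rewrite cardH.
  have [y Hy oy] := Cauchy (isT : prime 2) dvd2H.
  have ntG : 2 %| #[x] by rewrite (dvdn_trans _ expH) // -oy dvdn_exponent.
  have x2 : #[x] = 2%N.
    by move: ntG (order_gt0 x) n2; case: #[x] => [|[|[|]]].
  right; rewrite (isog_abelem_card _ abelG) cardG x2 cardH cardsT card_prod !card_ord eqxx andbT.
  rewrite abelemE //; apply/andP; split.
    by apply/centsP=> [[a b]] _ [c d] _; congr (_, _); apply: Zp_mulgC.
  apply/exponentP=> [[a b]] _; congr (_, _).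
    by case: a => [[|[|//]] ?]; apply: val_inj.
  by case: b => [[|[|//]] ?]; apply: val_inj.
left; exists #[x]; first by move: (order_gt0 x) n2; case: #[x] => [|[|[|]]].
have -> : G :=: <[x]> by rewrite -defG' (card1_trivg cardH) mulg1.
by rewrite isog_sym Zp_isog.
Qed.

Lemma class_gt1 (gT : finGroupType) (G : {group gT}) (x : gT) :
  x \in G -> x \notin 'Z(G) -> 1 < #|x ^: G|.
Proof.
move=> Gx; apply: contraR; rewrite -index_cent1 -leqNgt => le1.
have : #|G : 'C_G[x]| == 1%N by rewrite eqn_leq le1 indexg_gt0.
rewrite indexg_eq1 subsetI subxx /= => cGx.
by rewrite inE Gx -sub_cent1.
Qed.

(** Noncentral classes have at least two elements, and a second class in the orbit would make four
    elements. So automorphisms stabilize every noncentral class, and it suffices to construct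
    automorphisms that do not. *)
Lemma orbit_maol_leq3 (gT : finGroupType) (G : {group gT}) (x y : gT) :
  maol G <= 3 -> x \in G -> x \notin 'Z(G) ->
  y \in orbit 'P%act (Aut G) x -> y \in x ^: G.
Proof.
move=> maolG Gx nZx Oy; have [a Aa /= yE] := orbitP Oy; rewrite /aperm in yE.
have Gy : y \in G by rewrite -yE Aut_closed.
have nZy : y \notin 'Z(G).
  apply: contra nZx => Zy; have /andP[_ /forall_inP charZ] := center_char G.
  have Aa' : (a^-1)%g \in Aut G by rewrite groupV.
  by rewrite -[x](permK a) yE; apply: (subsetP (charZ _ Aa')); apply: imset_f.
apply: contraT => nxy; have /maol_leqP/(_ x Gx) := maolG; rewrite leqNgt.
move/negP; case.
have disj : x ^: G :&: y ^: G = set0.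
  apply/eqP; apply: contraNT nxy => /set0Pn[z /setIP[/class_eqP xz /class_eqP yz]].
  by rewrite -xz yz class_refl.
apply: (@leq_trans #|x ^: G :|: y ^: G|).
  by rewrite cardsU disj cards0 subn0 (@leq_add 2 2) ?class_gt1.
apply: subset_leq_card; rewrite subUset class_sub_Aut_orbit //.
by have /orbit_eqP <- := Oy; apply: class_sub_Aut_orbit.
Qed.

Lemma nabelianP (gT : finGroupType) (G : {group gT}) : ~~ abelian G ->
  exists a b, [/\ a \in G, b \in G & [~ a, b] != 1].
Proof.
case: (boolP [exists a in G, [exists b in G, [~ a, b] != 1]]).
  by case/exists_inP=> a Ga /exists_inP[b Gb ntab] _; exists a, b.
rewrite negb_exists_in => /forall_inP cGG /negP[]; apply/centsP=> a Ga b Gb.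
by apply/commgP; have := cGG a Ga; rewrite negb_exists_in => /forall_inP/(_ b Gb)/negPn.
Qed.

(** * Class two groups whose noncentral classes all have prime size p *)

Section ClassTwo.

Variables (gT : finGroupType) (G : {group gT}) (p : nat).
Hypotheses (maolG : maol G <= 3) (p_pr : prime p) (sG'Z : G^`(1) \subset 'Z(G)).
Hypothesis (cent_p : {in G, forall a, a \notin 'Z(G) -> #|G : 'C_G[a]| = p}).

Let commZ a b : a \in G -> b \in G -> [~ a, b] \in 'Z(G).
Proof. by move=> Ga Gb; rewrite (subsetP sG'Z) // mem_commg. Qed.

Let comm_central z g : z \in 'Z(G) -> g \in G -> commute g z.
Proof. by move=> /centerP[_ cz] Gg; apply/commute_sym; apply: cz. Qed.

Let conjZ z g : z \in 'Z(G) -> g \in G -> z ^ g = z.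
Proof. by move=> Zz Gg; rewrite conjgE -(comm_central Zz Gg) mulKg. Qed.

Let sZC a : a \in G -> 'Z(G) \subset 'C_G[a].
Proof. by move=> Ga; rewrite setIS // -cent_set1 centS ?sub1set. Qed.

Let normC a : a \in G -> 'C_G[a] <| G.
Proof.
move=> Ga; apply: sub_der1_normal; last exact: subsetIl.
exact: subset_trans (sZC Ga).
Qed.

Let nZ_comm a b : a \in G -> b \in G -> [~ a, b] != 1 -> a \notin 'Z(G).
Proof.
move=> Ga Gb; apply: contraNN => /centerP[_ /(_ b Gb)/commgP]; exact.
Qed.

(** [b] and [b * u] act alike on ['C_G[a]], because [u] centralizes it. The identity there extends
    by [b] to [b * u] once the p-th powers agree, and the orbit bound makes the two conjugate. *)
Let mul_class a b u : a \in G -> b \in G -> [~ a, b] != 1 ->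
  u \in 'C_G[a] -> u \in 'C('C_G[a]) -> (b * u) ^+ p = b ^+ p -> b * u \in b ^: G.
Proof.
move=> Ga Gb ntab Cu cCu bu_p; have [Gu _] := setIP Cu.
have nZa := nZ_comm Ga Gb ntab.
have nZb : b \notin 'Z(G) by apply: (nZ_comm Gb Ga); rewrite -invgR invg_eq1.
have Kb : b \notin 'C_G[a].
  by rewrite inE Gb; apply: contra ntab => /cent1P cab; apply/commgP.
apply: orbit_maol_leq3 => //.
apply: (mem_Aut_orbit_ext (K := [group of 'C_G[a]]) (f := idm_morphism _)); rewrite ?normC //=.
- by rewrite cent_p.
- exact: im_idm.
- have -> : b * u = u ^ b^-1 * b by rewrite conjgE invgK mulgA mulgKV.
  rewrite mem_rcoset mulgK memJ_norm ?groupV //.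
  exact: (subsetP (normal_norm (normC Ga))).
- move=> k Ck /=; rewrite conjgM.
  have Ckb : k ^ b \in 'C_G[a] by rewrite memJ_norm // (subsetP (normal_norm (normC Ga))).
  by rewrite [RHS]conjgE -(centP cCu _ Ckb) mulKg.
by rewrite cent_p.
Qed.

(** Otherwise [b * a] is conjugate to [b], so [a] is a commutator and therefore central. *)
Lemma noncommuting_expg a b : a \in G -> b \in G -> [~ a, b] != 1 ->
  (b * a) ^+ p != b ^+ p.
Proof.
move=> Ga Gb ntab; apply/eqP=> ba_p.
have nZa := nZ_comm Ga Gb ntab.
have Ca : a \in 'C_G[a] by apply/setIP; split=> //; apply: cent1id.
have cCa : a \in 'C('C_G[a]) by apply/centP=> k /setIP[_ /cent1P].
have /imsetP[g Gg baE] := mul_class Ga Gb ntab Ca cCa ba_p.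
have aE : a = [~ b, g] by rewrite commgEl -baE mulKg.
by rewrite aE commZ in nZa.
Qed.

(** [W] is the group of p-th powers in the center. Its index is the number of central [z] with
    [z ^+ p = 1], and these translate a noncentral [b] inside its class, which has p elements. *)
Lemma center_exponents : ~~ abelian G -> exists W : {group gT},
  [/\ W \subset 'Z(G), #|'Z(G) : W| <= p, {in 'Z(G), forall z, z ^+ p \in W}
    & forall w, w \in W -> exists2 z, z \in 'Z(G) & w = z ^+ p].
Proof.
move=> /nabelianP[a [b [Ga Gb ntab]]].
have abZ := center_abelian G.
have fM : {in 'Z(G) &, {morph expgn^~ p : x y / x * y}}.
  by move=> x y Zx Zy /=; rewrite expgMn //; apply: (centsP abZ).
pose f := Morphism fM; exists [group of f @* 'Z(G)].
have sWZ : f @* 'Z(G) \subset 'Z(G).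
  by apply/subsetP=> _ /morphimP[z Zz _ ->]; apply: groupX.
split=> //=; last by move=> w /morphimP[z Zz _ ->]; exists z.
  2: by move=> z Zz; rewrite -[z ^+ p]/(f z) mem_morphim.
have := Lagrange sWZ; rewrite -[RHS](Lagrange (subsetIl 'Z(G) ('ker f))) mulnC.
rewrite card_morphim setIid indexgI => /eqP; rewrite eqn_pmul2r ?indexg_gt0 // => /eqP->.
have nZb : b \notin 'Z(G) by apply: (nZ_comm Gb Ga); rewrite -invgR invg_eq1.
rewrite -(cent_p Gb nZb) index_cent1 -(card_imset _ (mulgI b)).
apply/subset_leq_card/subsetP=> _ /imsetP[z /setIP[Zz /kerP-/(_ Zz)/= zp1] ->].
apply: (mul_class Ga) => //; first exact: (subsetP (sZC Ga)).
  by apply/centP=> k /setIP[Gk _]; apply/commute_sym/(comm_central Zz).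
by rewrite expgMn ?zp1 ?mulg1 //; apply: comm_central.
Qed.

Let commp a g : a \in G -> g \in G -> [~ a, g] ^+ p = 1.
Proof.
move=> Ga Gg; have [Za | nZa] := boolP (a \in 'Z(G)).
  by have /centerP[_ /(_ g Gg)/commgP/eqP->] := Za; rewrite expg1n.
rewrite -commgX; last by apply: comm_central; rewrite ?commZ.
apply/eqP/commgP/cent1P; suff /setIP[] : g ^+ p \in 'C_G[a] by rewrite cent1C.
have nCg : g \in 'N('C_G[a]) by rewrite (subsetP (normal_norm (normC Ga))).
apply: coset_idr; first exact: groupX.
rewrite morphX //= -(cent_p Ga nZa) -card_quotient ?normal_norm ?normC //.
by rewrite expg_cardG ?mem_quotient.
Qed.

Let exppZ a : a \in G -> a ^+ p \in 'Z(G).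
Proof.
move=> Ga; apply/centerP; split=> [|g Gg]; first exact: groupX.
apply/commgP; rewrite commXg ?commp //.
by apply: comm_central; rewrite ?commZ.
Qed.

Let expMp a b : a \in G -> b \in G ->
  (b * a) ^+ p = b ^+ p * a ^+ p * [~ a, b] ^+ 'C(p, 2).
Proof. by move=> Ga Gb; apply: expMg_Rmul; apply: comm_central; rewrite ?commZ. Qed.

(** The center has at most p cosets modulo [W], while two noncommuting elements produce p + 1 of
    them. *)
Lemma class_two_abelian : (p == 2%N) || (p == 3%N) -> abelian G.
Proof.
move=> p23; apply: contraT => nabG.
have [W [sWZ iW powW expW]] := center_exponents nabG.
have [a [b [Ga Gb ntab]]] := nabelianP nabG.
(* If this product were [w ^+ p] with [w] central, then [u * w^-1] and [v] would contradict
   [noncommuting_expg]. *)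
have W_root u v : u \in G -> v \in G -> [~ u, v] != 1 -> 
    u ^+ p * [~ u, v] ^+ 'C(p, 2) \notin W.
  move=> Gu Gv ntuv; apply/negP=> /expW[w Zw uE].
  have [Gw cw] := centerP _ _ Zw.
  have cvw : commute w^-1 v by apply/commute_sym; apply: comm_central; rewrite ?groupV.
  have uvw : [~ u * w^-1, v] = [~ u, v].
    rewrite commMgJ (eqP (introT commgP cvw)) mulg1.
    by rewrite conjZ ?commZ ?groupV.
  have := @noncommuting_expg (u * w^-1) v (groupM Gu (groupVr Gw)) Gv.
  rewrite uvw => /(_ ntuv)/negP[]; apply/eqP.
  rewrite expMp ?groupM ?groupV // uvw -mulgA -[RHS]mulg1; congr (_ * _).
  rewrite expgMn; last by apply: comm_central; rewrite ?groupV.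
  have cwc : commute (w^-1 ^+ p) ([~ u, v] ^+ 'C(p, 2)).
    by apply: comm_central; rewrite ?groupX ?groupV ?commZ.
  by rewrite -mulgA cwc mulgA uE expgVn mulgV.
have rcosZ z : z \in 'Z(G) -> W :* z \in rcosets W 'Z(G).
  by move=> Zz; rewrite -rcosetE imset_f.
have eq_rcos x y : (W :* x == W :* y) = (x * y^-1 \in W).
  by rewrite (sameP eqP rcoset_eqP) mem_rcoset.
have ntba : [~ b, a] != 1 by rewrite -invgR invg_eq1.
have Zexp x y n : x \in G -> y \in G -> [~ x, y] ^+ n \in 'Z(G).
  by move=> Gx Gy; rewrite groupX ?commZ.
case/orP: p23 => p_eq.
  (* [u * v] is the same expression formed from [a * b] and [b], so it also avoids [W] and the three
     cosets differ. *)
  pose u := a ^+ p * [~ a, b] ^+ 'C(p, 2); pose v := b ^+ p * [~ b, a] ^+ 'C(p, 2).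
  have Zu : u \in 'Z(G) by rewrite groupM ?exppZ ?Zexp.
  have Zv : v \in 'Z(G) by rewrite groupM ?exppZ ?Zexp.
  have nuW : u \notin W := W_root _ _ Ga Gb ntab.
  have nvW : v \notin W := W_root _ _ Gb Ga ntba.
  have abb : [~ a * b, b] = [~ a, b].
    by rewrite commMgJ commgg mulg1 conjZ ?commZ.
  have uvE : u * v = (a * b) ^+ p * [~ a * b, b] ^+ 'C(p, 2).
    rewrite abb expMp // /u /v -!mulgA; congr (_ * _).
    rewrite [in RHS]mulgA; apply/commute_sym/comm_central; rewrite ?Zexp //.
    by rewrite groupM ?groupX // (subsetP (center_sub G)) ?commZ.
  have nuvW : u * v \notin W by rewrite uvE W_root ?groupM // abb.
  have uniq3 : uniq [:: W :* 1; W :* u; W :* v^-1].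
    rewrite /= !inE !eq_rcos !mul1g invgK !groupV.
    by rewrite (negPf nuW) (negPf nvW) (negPf nuvW).
  move: iW; rewrite leqNgt (eqP p_eq) => /negP[].
  have /= <- := card_uniqP uniq3; apply/subset_leq_card/subsetP=> K.
  by rewrite !inE => /or3P[] /eqP->; rewrite rcosZ ?groupV.
(* For p = 3 the binomial coefficient is 3 and kills commutators, so cubing is multiplicative. *)
have C3 x y : x \in G -> y \in G -> [~ x, y] ^+ 'C(p, 2) = 1.
  by move=> Gx Gy; have := commp Gx Gy; rewrite (eqP p_eq).
have W_root3 x y : x \in G -> y \in G -> [~ x, y] != 1 -> x ^+ p \notin W.
  by move=> Gx Gy /(W_root _ _ Gx Gy); rewrite C3 // mulg1.
have naW := W_root3 _ _ Ga Gb ntab; have nbW := W_root3 _ _ Gb Ga ntba.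
have nb_aW x : x \in <[a]> -> b ^+ p * x ^+ p \notin W.
  move=> /cycleP[i ->]; have Gai := groupX i Ga.
  have bxa : [~ b * a ^+ i, a] = [~ b, a] ^ (a ^+ i).
    rewrite commMgJ; have /commgP/eqP-> : commute (a ^+ i) a by apply/commute_sym/commuteX.
    by rewrite mulg1.
  have -> : b ^+ p * (a ^+ i) ^+ p = (b * a ^+ i) ^+ p.
    by rewrite expMp // C3 // mulg1.
  by apply: (W_root3 _ a); rewrite ?groupM // bxa conjg_eq1.
have sqW z : z \in 'Z(G) -> z \notin W -> z * z \notin W.
  move=> Zz; apply: contra => Wzz; have := powW z Zz.
  by rewrite (eqP p_eq) expgS -[z ^+ 2]/(z * z) groupMr.
have c_ab : commute (b ^+ p) (a ^+ p) by apply: comm_central; rewrite ?exppZ ?groupX.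
have nabW : a ^+ p * b ^+ p \notin W by rewrite -c_ab nb_aW ?cycle_id.
have naVbW : (a ^+ p)^-1 * b ^+ p \notin W.
  have <- : b ^+ p * (a ^+ p)^-1 = (a ^+ p)^-1 * b ^+ p by apply: commuteV.
  by rewrite -expgVn nb_aW ?groupV ?cycle_id.
have uniq4 : uniq [:: W :* 1; W :* (a ^+ p); W :* (a ^+ p)^-1; W :* (b ^+ p)^-1].
  rewrite /= !inE !eq_rcos !mul1g !invgK !groupV (negPf naW) (negPf nbW).
  by rewrite (negPf nabW) (negPf naVbW) (negPf (sqW _ (exppZ Ga) naW)).
move: iW; rewrite leqNgt (eqP p_eq) => /negP[].
have /= <- := card_uniqP uniq4; apply/subset_leq_card/subsetP=> K.
by rewrite !inE => /or4P[] /eqP->; rewrite rcosZ ?groupV ?exppZ.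
Qed.

End ClassTwo.

(** * Groups mapping onto Sym(3) *)

Lemma card_S3 : #|[set: 'S_3]| = 6.
Proof. by have := card_Sym 'I_3; rewrite card_ord. Qed.

Lemma odd_class_S3 (s : 'S_3) : odd_perm s -> #|s ^: [set: 'S_3]| = 3.
Proof.
move=> odd_s.
have s2 : 2 %| #|'C_[set: 'S_3][s]|.
  apply: (@dvdn_trans #[s]); last by rewrite order_dvdG //; apply/setIP; rewrite inE cent1id.
  have oddX n : odd_perm (s ^+ n) = odd n && odd_perm s.
    by elim: n => [|n IHn]; rewrite ?odd_perm1 // expgS odd_permM IHn /= odd_s; case: (odd n).
  by have := oddX #[s]; rewrite expg_order odd_perm1 odd_s andbT dvdn2 => <-.
have := index_cent1 [set: 'S_3] s; have := Lagrange (subsetIl [set: 'S_3] 'C[s]).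
rewrite card_S3; move: s2 => /dvdnP[m ->] eq6 <-.
have nC : #|[set: 'S_3] : 'C_[set: 'S_3][s]| != 1%N.
  rewrite indexg_eq1 subsetI subxx sub_cent1; apply/negP => /centP cs.
  have [i si] : exists i, s i != i.
    apply/existsP; apply: contraTT odd_s; rewrite negb_exists => /forallP s1.
    suff -> : s = 1 by rewrite odd_perm1.
    by apply/permP=> i; rewrite perm1; apply/eqP; have := s1 i; rewrite negbK.
  have [j /andP[ji jsi]] : exists j, (j != i) && (j != s i).
    have : 0 < #|~: [set i; s i]|.
      by rewrite cardsCs setCK cards2 card_ord; case: (i != s i).
    by case/card_gt0P=> j; rewrite !inE negb_or => js; exists j.
  have /permP/(_ i) := cs (tperm (s i) j) (in_setT _).
  rewrite !permM tpermL tpermD // 1?eq_sym //.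
  by move/eqP; rewrite (negPf jsi).
move: eq6 nC (indexg_gt0 [set: 'S_3] 'C_[set: 'S_3][s]).
set d := #|_ : _|; move=> eq6 d1 d0; clearbody d.
have md3 : (m * d = 3)%N by move: eq6; rewrite mulnAC => eq6; apply/eqP; rewrite -(eqn_pmul2r (isT : 0 < 2)) eq6.
have : d %| 3 by rewrite -md3 dvdn_mull.
by rewrite dvdn_divisors // !inE (negPf d1) => /eqP.
Qed.

(** An odd permutation already has three conjugates, so [f] is injective on the class of any element
    above it, and no automorphism moves such an element within its fibre ([stay]). Two automorphisms
    built on the index 2 subgroup [K] then kill the kernel. *)
Lemma maol_leq3_S3 (gT : finGroupType) (G : {group gT}) (f : {morphism G >-> 'S_3}) :
  maol G <= 3 -> f @* G = [set: 'S_3] -> G \isog [set: 'S_3].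
Proof.
move=> maolG fG.
have fsurj s : exists2 g, g \in G & f g = s.
  by have /morphimP[g Gg _ ->] : s \in f @* G; [rewrite fG inE | exists g].
have comm_odd t h : t \in G -> h \in G -> odd_perm (f t) -> commute (f t) (f h) ->
    commute t h.
  move=> Gt Gh odd_t; apply: commute_lift => //.
  rewrite fG odd_class_S3 // -index_cent1; exact: index_cent1_maol.
have [t Gt ft] := fsurj (tperm ord0 ord_max).
have odd_t : odd_perm (f t) by rewrite ft odd_tperm.
(* The kernel commutes with the elements above odd permutations, and every other element is a
   product of two of these. *)
have ker_cent d h : d \in 'ker f -> h \in G -> commute d h.
  move=> kd Gh; have Gd : d \in G := dom_ker kd.
  have odd_comm h' : h' \in G -> odd_perm (f h') -> commute d h'.
    move=> Gh' odd_h'; apply/commute_sym; apply: comm_odd => //.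
    by rewrite (mker kd); apply: commute1.
  case odd_h : (odd_perm (f h)); first exact: odd_comm.
  rewrite -(mulKVg t h); apply: commuteM; first exact: odd_comm.
  apply: odd_comm; first by rewrite groupM ?groupV.
  by rewrite morphM ?groupV // morphV // odd_permM odd_permV odd_t odd_h.
have oddM : {in G &, {morph (fun g => odd_perm (f g)) : g h / g * h >-> (g * h : bool)}}.
  by move=> g h Gg Gh; rewrite morphM // odd_permM.
pose h := Morphism oddM.
pose K := ('ker h)%G.
have KE g : g \in G -> (g \in K) = ~~ odd_perm (f g).
  by move=> Gg; rewrite !inE Gg /=; case: (odd_perm _).
have nsKG : K <| G := ker_normal h.
have iK : #|G : K| = 2.
  have hG : h @* G = [set: bool].
    apply/setP=> b; rewrite inE; apply/morphimP.
    by case: b; [exists t | exists 1] => //=; rewrite morph1 odd_perm1.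
  by have := card_morphim h G; rewrite setIid hG cardsT card_bool.
have nZodd u : u \in G -> odd_perm (f u) -> u \notin 'Z(G).
  move=> Gu odd_u; apply/negP=> /centerP[_ cu].
  have : #|f u ^: (f @* G)| = 3 by rewrite fG odd_class_S3.
  have -> : f u ^: (f @* G) = [set f u].
    rewrite -morphim_class //.
    have -> : u ^: G = [set u] by apply/cent_classP/centP => v Gv; apply: cu.
    by rewrite morphim_set1.
  by rewrite cards1.
have stay u v : u \in G -> odd_perm (f u) -> f v = f u ->
    v \in orbit 'P%act (Aut G) u -> v = u.
  move=> Gu odd_u fv /(orbit_maol_leq3 maolG Gu (nZodd u Gu odd_u))/imsetP[g Gg vE].
  apply/esym; rewrite vE; apply/eqP; rewrite eq_sym; apply/eqP/conjg_fixP/commgP.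
  apply: comm_odd => //; apply/commgP/conjg_fixP.
  by rewrite -morphJ // -vE.
have Kker z : z \in 'ker f -> z \in K.
  by move=> kz; rewrite KE ?(dom_ker kz) // (mker kz) odd_perm1.
(* The automorphism is trivial on [K] and sends [t] to [t * z]. *)
have ker_exp2 z : z \in 'ker f -> z ^+ 2 = 1 -> z = 1.
  move=> kz z2; have Gz := dom_ker kz.
  apply: (mulgI t); rewrite mulg1; apply: stay; rewrite ?morphM ?(mker kz) ?mulg1 //.
  apply: (mem_Aut_orbit_ext (K := K) (f := idm_morphism _)); rewrite ?iK ?KE ?odd_t //=.
  - exact: im_idm.
  - by rewrite -(ker_cent z t) // mem_rcoset mulgK Kker.
  - move=> k /dom_ker Gk; rewrite conjgM; apply/esym/conjg_fixP/commgP/commute_sym.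
    by apply: ker_cent; rewrite ?groupJ.
  by rewrite expgMn ?z2 ?mulg1 //; apply/commute_sym/ker_cent.
have odd_ker : odd #|'ker f|.
  rewrite -[odd _]negbK -dvdn2; apply/negP=> /(Cauchy (isT : prime 2))[z kz oz].
  have z1 : z = 1 by apply: ker_exp2; rewrite // -oz expg_order.
  by rewrite z1 order1 in oz.
have sfK : 'ker f \subset K by apply/subsetP=> z; apply: Kker.
have ft2 : f t * f t = 1 by rewrite ft tperm2.
have kt2 : t ^+ 2 \in 'ker f.
  by apply/kerP; rewrite ?groupX // morphX // expgS expg1.
(* [t ^+ 2] lies in the kernel, whose order is odd: this power of [t] is an involution with the same
   image. *)
pose s := t ^+ #|'ker f|.
have Gs : s \in G by rewrite groupX.
have s2 : s ^+ 2 = 1 by rewrite -expgM mulnC expgM expg_cardG.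
have fs : f s = f t.
  rewrite /s -(odd_double_half #|'ker f|) odd_ker addSn add0n expgS -mul2n expgM.
  by rewrite morphM ?groupX // (mker (groupX _ kt2)) mulg1.
have abK : abelian K.
  apply: (@cyclic_factor_abelian _ ('ker f)%G).
    rewrite subsetI sfK; apply/centsP=> z kz k Kk; apply: ker_cent => //.
    by rewrite (subsetP (normal_sub nsKG)).
  apply: prime_cyclic; rewrite card_quotient; last first.
    by rewrite (subset_trans (normal_sub nsKG)) ?normal_norm ?ker_normal.
  have : #|G : 'ker f| = 6 by have := card_morphim f G; rewrite setIid fG card_S3.
  by rewrite -(Lagrange_index (normal_sub nsKG) sfK) iK mul2n => /(congr1 half); rewrite doubleK => ->.
have iM : {in K &, {morph invg : x y / x * y}}.
  by move=> x y Kx Ky; rewrite invMg; apply: (centsP abK); rewrite groupV.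
(* Here the automorphism inverts [K] and sends [s * z] to [s * z^-1], which forces [z ^+ 2 = 1]. *)
have ker1 : 'ker f = 1.
  apply/trivgP/subsetP=> z kz; rewrite inE; apply/eqP; have Gz := dom_ker kz.
  apply: ker_exp2 => //; apply: (mulgI (s * z^-1)); rewrite mulg1.
  rewrite expgS expg1 mulgA mulgKV; apply/esym.
  have fsz w : w \in 'ker f -> f (s * w) = f t.
    by move=> kw; rewrite morphM ?(dom_ker kw) // fs (mker kw) mulg1.
  apply: stay; rewrite ?fsz ?groupV ?groupM ?odd_t //.
  have Ksz : s * z \notin K by rewrite KE ?groupM // fsz // odd_t.
  have czs w : w \in 'ker f -> (s * w) ^+ 2 = w ^+ 2.
    by move=> kw; rewrite expgMn ?s2 ?mul1g //; apply/commute_sym/ker_cent.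
  have Gsz : s * z \in G by rewrite groupM.
  apply: (@mem_Aut_orbit_ext _ G K (Morphism iM) (s * z) (s * z^-1) nsKG _ _ Gsz Ksz).
  - by rewrite iK.
  - apply/eqP; rewrite eqEcard; apply/andP; split.
      by apply/subsetP=> _ /morphimP[k Kk _ ->] /=; rewrite groupV.
    by rewrite card_injm //; apply/injmP=> x y _ _ /invg_inj.
  - have -> : s * z^-1 = z^-1 * z^-1 * (s * z).
      rewrite -(ker_cent z s kz Gs) mulgA mulgKV.
      by apply/commute_sym/ker_cent; rewrite ?groupV.
    by rewrite mem_rcoset mulgK Kker // groupM ?groupV.
  - move=> k Kk; rewrite /= -conjVg !conjgM.
    have Gks : (k^-1) ^ s \in G by rewrite groupJ ?groupV // (subsetP (normal_sub nsKG)).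
    have fixJ w : w \in 'ker f -> (k^-1 ^ s) ^ w = k^-1 ^ s.
      by move=> kw; apply/conjg_fixP/commgP/commute_sym/ker_cent.
    by rewrite !fixJ ?groupV.
  by rewrite iK !czs ?groupV //= expgVn.
by rewrite -fG; apply/sub_isog; rewrite ?ker1.
Qed.

Lemma card_leq3_cyclic (gT : finGroupType) (G : {group gT}) : #|G| <= 3 -> cyclic G.
Proof.
move=> cG; have [/card1_trivg-> | ntG] := eqVneq #|G| 1%N; first exact: cyclic1.
by apply: prime_cyclic; move: cG ntG (cardG_gt0 G); case: #|G| => [|[|[|[|]]]].
Qed.

(** Quotients by centralizers have order at most 3, so the derived group lies in every centralizer,
    that is, in the center. What remains is to see that all noncentral elements have the same
    index. *)
Lemma maol_leq3_normal_cent (gT : finGroupType) (G : {group gT}) :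
  maol G <= 3 -> {in G, forall x, 'C_G[x] <| G} -> abelian G.
Proof.
move=> maolG nsC.
have iC x : x \in G -> #|G : 'C_G[x]| <= 3 by apply: index_cent1_maol.
have sG'C x : x \in G -> G^`(1) \subset 'C_G[x].
  move=> Gx; apply: der1_min; first by rewrite normal_norm ?nsC.
  apply: cyclic_abelian; apply: card_leq3_cyclic.
  by rewrite card_quotient ?normal_norm ?nsC ?iC.
have sG'Z : G^`(1) \subset 'Z(G).
  apply/subsetP=> z G'z; apply/centerP; split=> [|x Gx].
    exact: (subsetP (der_sub 1 G)).
  by have /setIP[_ /cent1P] := subsetP (sG'C x Gx) z G'z.
have commZ a b : a \in G -> b \in G -> [~ a, b] \in 'Z(G).
  by move=> Ga Gb; rewrite (subsetP sG'Z) // mem_commg.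
have Zcomm z g : z \in 'Z(G) -> g \in G -> commute g z.
  by move=> /centerP[_ cz] Gg; apply/commute_sym; apply: cz.
have comm_exp a g n : a \in G -> g \in G -> #|G : 'C_G[a]| %| n -> [~ a, g] ^+ n = 1.
  move=> Ga Gg /dvdnP[m ->]; rewrite mulnC expgM -commgX; last by apply: Zcomm; rewrite ?commZ.
  suff /commgP/eqP-> : commute a (g ^+ #|G : 'C_G[a]|) by rewrite expg1n.
  have nCg : g \in 'N('C_G[a]) by rewrite (subsetP (normal_norm (nsC a Ga))).
  suff /setIP[_ /cent1P] : g ^+ #|G : 'C_G[a]| \in 'C_G[a] by apply: commute_sym.
  apply: coset_idr; first exact: groupX.
  rewrite morphX //= -card_quotient ?normal_norm ?nsC //.
  by rewrite expg_cardG ?mem_quotient.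
apply: contraT => nabG; have [a [b [Ga Gb ntab]]] := nabelianP nabG.
have nZa : a \notin 'Z(G).
  by apply: contra ntab => /centerP[_ /(_ b Gb)/commgP].
pose p := #|G : 'C_G[a]|.
have p_gt1 : 1 < p by rewrite /p index_cent1 class_gt1.
have p23 : (p == 2%N) || (p == 3%N).
  by move: p_gt1 (iC a Ga); rewrite -/p; case: (p) => [|[|[|[|]]]].
have p_pr : prime p by case/orP: p23 => /eqP->.
suff cent_p : {in G, forall x, x \notin 'Z(G) -> #|G : 'C_G[x]| = p}.
  by rewrite (class_two_abelian maolG p_pr sG'Z cent_p p23) in nabG.
(* If [a] and [x] have indices 2 and 3 in some order, the index of [a * x] divides one of them;
   comparing powers of commutators makes [a] or [x] central. *)
move=> x Gx nZx; apply: contraNeq (nZa) => neq_p.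
have q_gt1 : 1 < #|G : 'C_G[x]| by rewrite index_cent1 class_gt1.
have q_le3 := iC x Gx.
set q := #|G : 'C_G[x]| in neq_p q_gt1 q_le3 *.
have co_pq : coprime p q.
  by move: p23 neq_p q_gt1 q_le3 => /orP[] /eqP->; case: (q) => [|[|[|[|]]]].
have Gax : a * x \in G by rewrite groupM.
have commax g : g \in G -> [~ a * x, g] = [~ a, g] * [~ x, g].
  by move=> Gg; rewrite commMgJ (conjg_fixP _) //; apply/commgP/commute_sym/Zcomm; rewrite ?commZ.
have exp_ax g n : g \in G -> [~ a * x, g] ^+ n = [~ a, g] ^+ n * [~ x, g] ^+ n.
  move=> Gg; rewrite commax // expgMn //; apply: Zcomm; rewrite ?commZ //.
  by rewrite (subsetP (center_sub G)) ?commZ.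
have pq1 (z : gT) : z ^+ p = 1 -> z ^+ q = 1 -> z = 1.
  move=> zp zq; apply/eqP; rewrite -order_eq1 -dvdn1 -(eqnP co_pq).
  by rewrite dvdn_gcd !order_dvdn zp zq !eqxx.
have [n_p | n_q] : #|G : 'C_G[a * x]| %| p \/ #|G : 'C_G[a * x]| %| q.
  have := iC _ Gax; have := indexg_gt0 G 'C_G[a * x].
  move: p23 q_gt1 q_le3 neq_p => /orP[]/eqP->.
    by case: #|G : _| => [|[|[|[|]]]] //; case: (q) => [|[|[|[|]]]] //; auto.
  by case: #|G : _| => [|[|[|[|]]]] //; case: (q) => [|[|[|[|]]]] //; auto.
  case/negP: nZx; apply/centerP; split=> // g Gg; apply/commgP/eqP/pq1; last exact: comm_exp.
  have := comm_exp _ g p Gax Gg n_p; by rewrite exp_ax // (comm_exp a) ?mul1g.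
apply/centerP; split=> // g Gg; apply/commgP/eqP/pq1; first exact: comm_exp.
by have := comm_exp _ g q Gax Gg n_q; rewrite exp_ax // (comm_exp x) ?mulg1.
Qed.

Lemma maol_leq3_nonnormal_cent (gT : finGroupType) (G : {group gT}) (x : gT) :
  maol G <= 3 -> x \in G -> ~~ ('C_G[x] <| G) -> G \isog [set: 'S_3].
Proof.
move=> maolG Gx nnC.
have card3 : #|x ^: G| = 3.
  have : #|x ^: G| <= 3 by rewrite -index_cent1 index_cent1_maol.
  have : 0 < #|x ^: G| by rewrite -index_cent1.
  have : #|x ^: G| != 1%N.
    apply: contra nnC; rewrite -index_cent1 indexg_eq1 => sGC.
    by rewrite (_ : 'C_G[x] = G) ?normal_refl //; apply/eqP; rewrite eqEsubset subsetIl.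
  have : #|x ^: G| != 2%N.
    by apply: contra nnC; rewrite -index_cent1 => /eqP/index2_normal; apply; apply: subsetIl.
  by case: #|x ^: G| => [|[|[|[|]]]].
have actG : [acts G, on x ^: G | 'J] by rewrite astabsJ class_norm.
have [f [e [inj_e im_e fE]]] := action_perm (subsetT G) actG card3.
have [i0 xE] : exists i, x = e i.
  have : x \in e @: [set: 'I_3] by rewrite im_e class_refl.
  by case/imsetP=> i _ ->; exists i.
have sKC : 'ker f \subset 'C_G[x].
  apply/subsetP=> g kg; have Gg := dom_ker kg; rewrite inE Gg cent1C.
  apply/cent1P/commgP/conjg_fixP; have := fE g Gg i0.
  by rewrite (mker kg) perm1 -xE => <-.
(* The kernel is normal and the centralizer is not, so the image has order at least 3 * 2. *)
have neKC : 'ker f != 'C_G[x] by apply: contraNneq nnC => <-; apply: ker_normal.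
apply: (maol_leq3_S3 maolG (f := f)).
apply/eqP; rewrite eqEcard subsetT card_S3 card_morphim setIid.
rewrite -(Lagrange_index (subsetIl G 'C[x]) sKC) index_cent1 card3.
rewrite (@leq_pmul2l 3 2) // ltn_neqAle indexg_gt0 andbT eq_sym indexg_eq1.
by apply: contra neKC => sCK; rewrite eqEsubset sKC.
Qed.

Theorem maol_leq3_cases (gT : finGroupType) (G : {group gT}) : maol G <= 3 ->
  [\/ exists2 m : nat, m \in [:: 1; 2; 3; 4; 6]%N & G \isog Zp m,
      G \isog [set: 'Z_2 * 'Z_2] | G \isog [set: 'S_3]].
Proof.
move=> maolG.
have [nsC | ] := boolP [forall x in G, 'C_G[x] <| G].
  have abG := maol_leq3_normal_cent maolG (fun x Gx => forall_inP nsC x Gx).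
  by case: (abelian_maol_leq3 abG maolG); [constructor 1 | constructor 2].
rewrite negb_forall_in => /exists_inP[x Gx nnC].
by constructor 3; apply: maol_leq3_nonnormal_cent nnC.
Qed.

(** Suffices for the converse: in the listed groups no order is shared by more than three
    elements. *)
Lemma maol_leq_order (gT : finGroupType) (G : {group gT}) (c : nat) :
  (forall n, #|[set y in G | #[y] == n]| <= c) -> maol G <= c.
Proof.
move=> le_c; apply/maol_leqP=> x Gx; apply: leq_trans (le_c #[x]).
apply/subset_leq_card/subsetP=> _ /orbitP[a Aa <-]; rewrite inE /= /aperm.
by rewrite Aut_closed //= -(autmE Aa) order_injm ?injm_autm.
Qed.

Lemma isog_card_order (gT rT : finGroupType) (G : {group gT}) (H : {group rT}) (n : nat) :
  G \isog H -> #|[set y in G | #[y] == n]| = #|[set y in H | #[y] == n]|.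
Proof.
case/isogP=> f injf <-; rewrite -(card_in_imset (f := f)); last first.
  by move=> x y /setIdP[Gx _] /setIdP[Gy _]; apply: (injmP injf).
congr #|pred_of_set _|; apply/setP=> y; apply/imsetP/setIdP=> [[x /setIdP[Gx ox] ->] | []].
  by rewrite mem_morphim // order_injm.
by case/morphimP=> x _ Gx -> ox; exists x => //; rewrite inE Gx -(order_injm injf).
Qed.

Lemma card_order_cyclic (gT : finGroupType) (G : {group gT}) (n : nat) :
  cyclic G -> #|[set y in G | #[y] == n]| <= totient n.
Proof.
move=> cycG; have [->|[x]] := set_0Vmem [set y in G | #[y] == n]; first by rewrite cards0.
case/setIdP=> Gx /eqP <-; rewrite totient_gen; apply/subset_leq_card/subsetP=> y.
case/setIdP=> Gy /eqP oy; rewrite inE /generator eq_sym.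
by rewrite (eq_subG_cyclic cycG) ?cycle_subG // -!orderE oy.
Qed.

Lemma maol_leq3_converse (gT : finGroupType) (G : {group gT}) :
  [\/ exists2 m : nat, m \in [:: 1; 2; 3; 4; 6]%N & G \isog Zp m,
      G \isog [set: 'Z_2 * 'Z_2] | G \isog [set: 'S_3]] -> maol G <= 3.
Proof.
move=> isoG; apply: maol_leq_order => n.
case: isoG => [[m m_in isoG] | isoG | isoG].
- have cycG : cyclic G by rewrite (isog_cyclic isoG) /= /Zp; case: ifP; rewrite ?Zp_cycle ?cycle_cyclic ?cyclic1.
  have cardG : #|G| = m.
    by rewrite (card_isog isoG) card_Zp //; case: m m_in {isoG}.
  have [-> | [x /setIdP[Gx /eqP ox]]] := set_0Vmem [set y in G | #[y] == n].
    by rewrite cards0.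
  apply: leq_trans (card_order_cyclic n cycG) _.
  have: n \in divisors m by rewrite -dvdn_divisors -?ox -?cardG ?order_dvdG.
  have: all (fun m' => all (fun n' => totient n' <= 3) (divisors m')) [:: 1; 2; 3; 4; 6]%N by [].
  by move=> /allP/(_ m m_in)/allP; apply.
- have cardG : #|G| = 4%N by rewrite (card_isog isoG) cardsT card_prod !card_ord.
  have [-> | n1] := eqVneq n 1%N.
    apply: (@leq_trans #|[set 1 : gT]|); last by rewrite cards1.
    by apply/subset_leq_card/subsetP=> y /setIdP[_]; rewrite order_eq1 inE.
  apply: (@leq_trans #|G^#|); last by rewrite -ltnS -[4]/(3.+1) -cardG (cardsD1 1 G) group1.
  apply/subset_leq_card/subsetP=> y /setIdP[Gy oy]; rewrite !inE Gy andbT.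
  by apply: contraNneq n1 => y1; rewrite -(eqP oy) y1 order1.
rewrite (isog_card_order n isoG).
have cardA : #|'Alt_('I_3)| = 3.
  by apply/eqP; rewrite -(@eqn_pmul2l 2) // card_Alt card_ord.
have odd_ord (y : 'S_3) : odd_perm y -> #[y] %| 2.
  move=> odd_y; have := Lagrange (subsetIl [set: 'S_3] 'C[y]).
  rewrite index_cent1 odd_class_S3 // card_S3 => /eqP.
  rewrite -[6]/((2 * 3)%N) eqn_pmul2r // => /eqP cC.
  have : #[y] %| #|'C_[set: 'S_3][y]|.
    by rewrite order_dvdG //; apply/setIP; rewrite inE; split=> //; apply: cent1id.
  by rewrite cC.
have [-> | n2] := eqVneq n 2%N.
  apply: (@leq_trans #|~: 'Alt_('I_3)|); last by rewrite cardsCs setCK cardA -cardsT card_S3.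
  apply/subset_leq_card/subsetP=> y /setIdP[_ /eqP oy]; rewrite inE.
  by apply: contraTN (isT : 2 %| 2) => Ay; have := order_dvdG Ay; rewrite oy cardA.
apply: (@leq_trans #|'Alt_('I_3)|); last by rewrite cardA.
apply/subset_leq_card/subsetP=> y /setIdP[_ /eqP oy].
rewrite Alt_even; apply/negP => odd_y; have := odd_ord y odd_y.
rewrite oy; case: n n2 oy => [|[|[|n]]] // _; rewrite ?dvdn_gt0 //.
  by move/eqP; rewrite order_eq1 => /eqP y1; rewrite y1 odd_perm1 in odd_y.
Qed.

Lemma maol_leq3_finite :
  finitely_many_up_to_isog
    (fun (gT : finGroupType) (G : {group gT}) => maol G <= 3).
Proof.
pose ms := [:: 1; 2; 3; 4; 6]%N.
pose fam (i : 'I_7) : {hT : finGroupType & {group hT}} :=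
  if i < 5 then existT (fun hT : finGroupType => {group hT}) _ (Zp_group (nth 1%N ms i))
  else if i == 5 :> nat then existT (fun hT : finGroupType => {group hT}) _ [set: 'Z_2 * 'Z_2]%G
  else existT (fun hT : finGroupType => {group hT}) _ [set: 'S_3]%G.
exists 7, (fun i => projT1 (fam i)), (fun i => projT2 (fam i)) => gT G.
case/maol_leq3_cases=> [[m m_in isoG] | isoG | isoG].
- have lt5 : index m ms < 5 by rewrite -[5]/(size ms) index_mem.
  have lt7 : index m ms < 7 by apply: ltn_trans lt5 _.
  by exists (Ordinal lt7); rewrite /fam /= lt5 /= nth_index.
- by exists (inord 5); rewrite /fam /= inordK.
by exists (inord 6); rewrite /fam /= inordK.
Qed.

End SmallOrbits.

(** * A 2-group with automorphisms trivial modulo the center *)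

Section F2.

Lemma F2P (a : 'F_2) : a = 0 \/ a = 1.
Proof. by case: a => [[|[|//]] ?]; [left | right]; apply: val_inj. Qed.

Lemma F2_addrr (a : 'F_2) : a + a = 0.
Proof. by case: (F2P a) => ->; apply: val_inj. Qed.

Lemma F2_mulrr (a : 'F_2) : a * a = a.
Proof. by case: (F2P a) => ->; apply: val_inj. Qed.

Lemma F2_addr0_eq (a b : 'F_2) : a + b = 0 -> a = b.
Proof. by move/(congr1 (+%R^~ b)); rewrite -addrA F2_addrr addr0 add0r. Qed.

End F2.

Section Rigid.

Variable m : nat.

Local Notation X := 'rV['F_2]_m.+3.
Local Notation Y := 'rV['F_2]_m.+2.

Definition rig_quot := (X * Y)%type.
Definition rig_center := ('F_2 * 'F_2 * 'F_2)%type.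
HB.instance Definition _ := GRing.Zmodule.on rig_quot.
HB.instance Definition _ := Finite.on rig_quot.
HB.instance Definition _ := GRing.Zmodule.on rig_center.
HB.instance Definition _ := Finite.on rig_center.

Local Notation V := rig_quot.
Local Notation W := rig_center.

(** [lo] and [hi] drop the last and the first coordinate; they are the matrices [[I 0]] and [[0 I]]
    of the Kronecker pencil. *)
Definition lo (x : X) (j : 'I_m.+2) : 'F_2 := x 0 (widen_ord (leqnSn _) j).
Definition hi (x : X) (j : 'I_m.+2) : 'F_2 := x 0 (lift ord0 j).
Definition pair1 (x : X) (y : Y) : 'F_2 := \sum_j y 0 j * lo x j.
Definition pair2 (x : X) (y : Y) : 'F_2 := \sum_j y 0 j * hi x j.
Definition x0 (x : X) : 'F_2 := x 0 ord0.
Definition x1 (x : X) : 'F_2 := x 0 (lift ord0 ord0).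

(* The first two coordinates carry the Kronecker pencil; the terms in [x0] and
   [x1] separate the squares of the three rank one vectors, see [sq_E0],
   [sq_Ek] and [sq_ones]. *)
Definition rig_cocycle (u v : V) : W :=
  (pair1 v.1 u.2,
   pair2 v.1 u.2 + (x0 u.1 * x0 v.1 + x1 u.1 * x1 v.1),
   x1 u.1 * x1 v.1).
Local Notation b := rig_cocycle.

Lemma pair1Dl x x' y : pair1 (x + x') y = pair1 x y + pair1 x' y.
Proof. by rewrite /pair1 -big_split; apply: eq_bigr => j _; rewrite /lo mxE mulrDr. Qed.
Lemma pair1Dr x y y' : pair1 x (y + y') = pair1 x y + pair1 x y'.
Proof. by rewrite /pair1 -big_split; apply: eq_bigr => j _; rewrite mxE mulrDl. Qed.
Lemma pair2Dl x x' y : pair2 (x + x') y = pair2 x y + pair2 x' y.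
Proof. by rewrite /pair2 -big_split; apply: eq_bigr => j _; rewrite /hi mxE mulrDr. Qed.
Lemma pair2Dr x y y' : pair2 x (y + y') = pair2 x y + pair2 x y'.
Proof. by rewrite /pair2 -big_split; apply: eq_bigr => j _; rewrite mxE mulrDl. Qed.

Lemma rig_cocycleDl u u' v : b (u + u') v = b u v + b u' v.
Proof.
by congr (_, _, _); rewrite /= ?pair1Dr ?pair2Dr ?mxE /x0 /x1 ?mxE; ring.
Qed.
Lemma rig_cocycleDr u v v' : b u (v + v') = b u v + b u v'.
Proof.
by congr (_, _, _); rewrite /= ?pair1Dl ?pair2Dl ?mxE /x0 /x1 ?mxE; ring.
Qed.

Definition rig := (V * W)%type.
HB.instance Definition _ := Finite.on rig.

Definition rig_mul (g h : rig) : rig := (g.1 + h.1, g.2 + h.2 + b g.1 h.1).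
Definition rig_one : rig := (0, 0).
Definition rig_inv (g : rig) : rig := (- g.1, - g.2 - b (- g.1) g.1).

Lemma rig_cocycle0l v : b 0 v = 0.
Proof. by apply: (addrI (b 0 v)); rewrite -rig_cocycleDl !addr0. Qed.
Lemma rig_cocycle0r v : b v 0 = 0.
Proof. by apply: (addrI (b v 0)); rewrite -rig_cocycleDr !addr0. Qed.

Lemma rig_mulA : associative rig_mul.
Proof.
move=> g h k; rewrite /rig_mul /= addrA rig_cocycleDl rig_cocycleDr; congr (_, _).
by rewrite !addrA [LHS](ACl (1*2*5*3*6*4)).
Qed.
Lemma rig_mul1g : left_id rig_one rig_mul.
Proof. by move=> [v w]; rewrite /rig_mul /= rig_cocycle0l addr0 !add0r. Qed.
Lemma rig_mulVg : left_inverse rig_one rig_inv rig_mul.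
Proof.
move=> g; rewrite /rig_mul /rig_inv /= addNr; congr (_, _).
by rewrite addrAC subrK addNr.
Qed.
HB.instance Definition _ := Finite_isGroup.Build rig rig_mulA rig_mul1g rig_mulVg.

Lemma rigM (g h : rig) : (g * h)%g = (g.1 + h.1, g.2 + h.2 + b g.1 h.1) :> rig.
Proof. by []. Qed.

Local Notation k := m.+2.

Definition c1 (u v : V) := pair1 u.1 v.2 + pair1 v.1 u.2.
Definition c2 (u v : V) := pair2 u.1 v.2 + pair2 v.1 u.2.
(** The commutator map of the extension. The third central coordinate is reached by squares but not
    by commutators, since the terms added to the pencil are symmetric. *)
Definition rig_form (u v : V) : W := (c1 u v, c2 u v, 0).

Lemma rig_formE u v : b u v = b v u + rig_form u v.
Proof.
congr (_, _, _); rewrite /= /c1 /c2.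
- by rewrite addrA F2_addrr add0r.
- by rewrite -[LHS]addr0 -(F2_addrr (pair2 u.1 v.2)); ring.
- by rewrite addr0 mulrC.
Qed.

Definition xc (v : V) (i : nat) := v.1 0 (inord i).
Definition yc (v : V) (j : nat) := v.2 0 (inord j).
Definition E (i : nat) : V := (delta_mx 0 (inord i), 0).
Definition F (j : nat) : V := (0, delta_mx 0 (inord j)).

Lemma pair10l y : pair1 0 y = 0.
Proof. by rewrite /pair1 big1 // => j _; rewrite /lo mxE mulr0. Qed.
Lemma pair10r x : pair1 x 0 = 0.
Proof. by rewrite /pair1 big1 // => j _; rewrite mxE mul0r. Qed.
Lemma pair20l y : pair2 0 y = 0.
Proof. by rewrite /pair2 big1 // => j _; rewrite /hi mxE mulr0. Qed.
Lemma pair20r x : pair2 x 0 = 0.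
Proof. by rewrite /pair2 big1 // => j _; rewrite mxE mul0r. Qed.

Lemma sum_F2_delta (y : Y) (i : nat) :
  \sum_j y 0 j * (j == i :> nat)%:R = if (i < k)%N then y 0 (inord i) else 0.
Proof.
case: ifP => [lti | lti].
  rewrite (bigD1 (inord i)) //= inordK // eqxx mulr1 big1 ?addr0 // => j neq_ji.
  suff /negPf-> : (j != i :> nat) by rewrite mulr0.
  by apply: contra neq_ji => /eqP ji; apply/eqP/val_inj; rewrite /= inordK.
rewrite big1 // => j _; suff /negPf-> : (j != i :> nat) by rewrite mulr0.
by apply: contraFneq lti => <-.
Qed.

Lemma lo_delta i j : (i <= k)%N ->
  lo (delta_mx 0 (inord i)) j = (j == i :> nat)%:R.
Proof. by move=> lei; rewrite /lo mxE /= -val_eqE /= inordK. Qed.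

Lemma hi_delta i j : (i <= k)%N ->
  hi (delta_mx 0 (inord i)) j = (j.+1 == i :> nat)%:R.
Proof. by move=> lei; rewrite /hi mxE /= -val_eqE /= inordK. Qed.

Lemma c1E u i : (i <= k)%N -> c1 u (E i) = if (i < k)%N then yc u i else 0.
Proof.
move=> lei; rewrite /c1 /= pair10r add0r; apply: etrans (sum_F2_delta _ _).
by apply: eq_bigr => j _; rewrite lo_delta.
Qed.

Lemma c2E u i : (i < k)%N -> c2 u (E i.+1) = yc u i.
Proof.
move=> lti; rewrite /c2 /= pair20r add0r.
transitivity (if (i < k)%N then yc u i else 0); last by rewrite lti.
by apply: etrans (sum_F2_delta _ _); apply: eq_bigr => j _; rewrite hi_delta.
Qed.

Lemma c2E0 u : c2 u (E 0) = 0.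
Proof.
rewrite /c2 /= pair20r add0r; apply: big1 => j _.
by rewrite hi_delta // mulr0.
Qed.

Lemma c1F u j : (j < k)%N -> c1 u (F j) = xc u j.
Proof.
move=> ltj; rewrite /c1 /= pair10l addr0 /pair1 (bigD1 (inord j)) //= big1 => [|i neq_ij].
  rewrite mxE !eqxx mul1r addr0 /lo /xc; congr (u.1 0 _); apply: val_inj.
  by rewrite /= !inordK // ltnS ltnW.
by rewrite mxE /= (negPf neq_ij) mul0r.
Qed.

Lemma c2F u j : (j < k)%N -> c2 u (F j) = xc u j.+1.
Proof.
move=> ltj; rewrite /c2 /= pair20l addr0 /pair2 (bigD1 (inord j)) //= big1 => [|i neq_ij].
  rewrite mxE !eqxx mul1r addr0 /hi /xc; congr (u.1 0 _); apply: val_inj.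
  by rewrite /= !inordK.
by rewrite mxE /= (negPf neq_ij) mul0r.
Qed.

Lemma c1C u v : c1 u v = c1 v u. Proof. exact: addrC. Qed.
Lemma c2C u v : c2 u v = c2 v u. Proof. exact: addrC. Qed.

Lemma xcE i j : (i <= k)%N -> (j <= k)%N -> xc (E i) j = (j == i)%:R.
Proof. by move=> lei lej; rewrite /xc mxE eqxx /= -val_eqE /= !inordK. Qed.
Lemma ycE i j : yc (E i) j = 0. Proof. by rewrite /yc mxE. Qed.
Lemma xcF i j : xc (F i) j = 0. Proof. by rewrite /xc mxE. Qed.
Lemma ycF i j : (i < k)%N -> (j < k)%N -> yc (F i) j = (j == i)%:R.
Proof. by move=> lei lej; rewrite /yc mxE eqxx /= -val_eqE /= !inordK. Qed.

Lemma rig_quotP u v :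
  (forall i, (i <= k)%N -> xc u i = xc v i) ->
  (forall j, (j < k)%N -> yc u j = yc v j) -> u = v.
Proof.
case: u v => [x y] [x' y']; rewrite /xc /yc /= => eqx eqy.
congr (_, _); apply/rowP => i.
  by have := eqx i; rewrite inord_val => -> //; rewrite -ltnS ltn_ord.
by have := eqy i; rewrite inord_val => -> //; rewrite ltn_ord.
Qed.

Lemma rig_form_eq0 u v : rig_form u v = 0 -> c1 u v = 0 /\ c2 u v = 0.
Proof.
move=> uv0; split; first exact: (congr1 (fun w : W => w.1.1) uv0).
exact: (congr1 (fun w : W => w.1.2) uv0).
Qed.

Lemma rig_form_nondeg u : (forall v, rig_form u v = 0) -> u = 0.
Proof.
move=> u0; have {}u0 v := rig_form_eq0 (u0 v).
apply: rig_quotP => i lei.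
  rewrite [RHS]mxE; case: i lei => [|i] lei; first by rewrite -c1F; case: (u0 (F 0)).
  by rewrite -c2F //; case: (u0 (F i)).
by rewrite [RHS]mxE -c2E //; case: (u0 (E i.+1)).
Qed.

(** * Vectors of rank one and their squares *)

Definition ones : V := (const_mx 1, 0).

Lemma xc_ones i : xc ones i = 1. Proof. by rewrite /xc mxE. Qed.
Lemma yc_ones i : yc ones i = 0. Proof. by rewrite /yc mxE. Qed.
Lemma xc0 i : xc 0 i = 0. Proof. by rewrite /xc mxE. Qed.
Lemma yc0 i : yc 0 i = 0. Proof. by rewrite /yc mxE. Qed.

(** Commutators with a lift of [v] take at most one nontrivial value; equivalently, [v] lies in the
    radical of [c1], [c2] or [c1 + c2]. *)
Definition rank1 v := exists w, forall u, rig_form v u = 0 \/ rig_form v u = w.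

Lemma rank1P v : rank1 v -> v <> 0 -> [\/ v = E 0, v = E k | v = ones].
Proof.
case=> [[[w1 w2] w3]] form_v nz_v.
have vw u : (c1 v u = 0 /\ c2 v u = 0) \/ (c1 v u = w1 /\ c2 v u = w2).
  have [/rig_form_eq0 vu | vu] := form_v u; first by left.
  right; split; first exact: (congr1 (fun w : W => w.1.1) vu).
  exact: (congr1 (fun w : W => w.1.2) vu).
(* Some nonzero functional on the plane over F_2 vanishes at [(w1, w2)]. *)
have [c2v | [c1v | c12v]] : (forall u, c2 v u = 0) \/ (forall u, c1 v u = 0) \/
    (forall u, c1 v u = c2 v u).
- case: (F2P w2) => w2E; [left | right; case: (F2P w1) => w1E; [left | right]] => u.
  + by case: (vw u) => -[_ ->].
  + by case: (vw u) => -[-> _].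
  + by case: (vw u) => -[-> ->] //; rewrite w1E w2E.
- have yv j : (j < k)%N -> yc v j = 0 by move=> ltj; rewrite -c2E.
  have xv j : (0 < j <= k)%N -> xc v j = 0 by case: j => // j ltj; rewrite -c2F.
  case: (F2P (xc v 0)) => xv0; [case: nz_v | constructor 1].
    apply: rig_quotP => i lei; rewrite ?xc0 ?yc0 ?yv //.
    by case: i lei => [|i] lei //; rewrite xv.
  apply: rig_quotP => i lei; rewrite ?ycE ?yv ?xcE //.
  by case: i lei => [|i] lei //; rewrite xv.
- have yv j : (j < k)%N -> yc v j = 0 by move=> ltj; rewrite -(c1v (E j)) c1E ?ltj // ltnW.
  have xv j : (j < k)%N -> xc v j = 0 by move=> ltj; rewrite -c1F.
  case: (F2P (xc v k)) => xv0; [case: nz_v | constructor 2].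
    apply: rig_quotP => i lei; rewrite ?xc0 ?yc0 ?yv //.
    by move: lei; rewrite leq_eqVlt => /predU1P[-> //|/xv].
  apply: rig_quotP => i lei; rewrite ?ycE ?yv ?xcE //.
  move: lei; rewrite leq_eqVlt => /predU1P[-> |lti]; first by rewrite eqxx.
  by rewrite xv // ltn_eqF.
have yv j : (j < k)%N -> yc v j = 0.
  elim: j => [|j IHj] ltj; first by rewrite -[LHS](c1E v (leq0n k)) c12v c2E0.
  have := c12v (E j.+1); rewrite c1E; last exact: ltnW.
  by rewrite ltj c2E ?IHj // ltnW.
have xv j : (j <= k)%N -> xc v j = xc v 0.
  elim: j => [|j IHj] // ltj.
  by rewrite -c2F // -c12v c1F // IHj // ltnW.
case: (F2P (xc v 0)) => xv0; [case: nz_v | constructor 3].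
  by apply: rig_quotP => i lei; rewrite ?xc0 ?yc0 ?yv ?xv.
by apply: rig_quotP => i lei; rewrite ?xc_ones ?yc_ones ?yv ?xv.
Qed.

Lemma rank1_E0 : rank1 (E 0).
Proof.
exists (1, 0, 0) => u; rewrite /rig_form c1C c2C c1E // c2E0.
by case: (F2P (yc u 0)) => ->; [left | right].
Qed.

Lemma rank1_Ek : rank1 (E k).
Proof.
exists (0, 1, 0) => u; rewrite /rig_form c1C c2C c1E // c2E // ltnn.
by case: (F2P (yc u m.+1)) => ->; [left | right].
Qed.

Lemma rank1_ones : rank1 ones.
Proof.
exists (1, 1, 0) => u; rewrite /rig_form.
have <- : c1 ones u = c2 ones u.
  rewrite /c1 /c2 /= pair10r pair20r !addr0 /pair1 /pair2.
  by apply: eq_bigr => j _; rewrite /lo /hi !mxE.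
by case: (F2P (c1 ones u)) => ->; [left | right].
Qed.

(** [b v v] is the square of any lift of [v], because V and W have exponent 2. *)
Lemma rig_sqE v : b v v =
  (pair1 v.1 v.2, pair2 v.1 v.2 + (xc v 0 + xc v 1), xc v 1).
Proof.
rewrite /b !F2_mulrr; have -> : x0 v.1 = xc v 0 by congr (v.1 0 _); apply: val_inj; rewrite /= inordK.
by have -> : x1 v.1 = xc v 1 by congr (v.1 0 _); apply: val_inj; rewrite /= inordK.
Qed.

Lemma sq_E0 : b (E 0) (E 0) = (0, 1, 0).
Proof. by rewrite rig_sqE /= pair10r pair20r !xcE // add0r addr0. Qed.
(** X has at least three coordinates, so [E k] misses the coordinates 0 and 1. *)
Lemma sq_Ek : b (E k) (E k) = 0.
Proof. by rewrite rig_sqE /= pair10r pair20r !xcE // add0r addr0. Qed.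
Lemma sq_ones : b ones ones = (0, 0, 1).
Proof. by rewrite rig_sqE /= pair10r pair20r !xc_ones add0r F2_addrr. Qed.

(** * Rigidity of the pencil together with its squares *)

Section Isometry.

Variables (A : V -> V) (D : W -> W).
Hypotheses (AD : forall u v, A (u + v) = A u + A v) (injA : injective A).
Hypotheses (D0 : D 0 = 0) (DD : forall w w', D (w + w') = D w + D w').
Hypothesis injD : injective D.
Hypothesis formA : forall u v, rig_form (A u) (A v) = D (rig_form u v).
Hypothesis sqA : forall v, b (A v) (A v) = D (b v v).

Let A0 : A 0 = 0. Proof. by apply: (addrI (A 0)); rewrite -AD !addr0. Qed.

Let surjA u : exists v, A v = u.
Proof. by exists (invF injA u); rewrite f_invF. Qed.

Let rank1A v : rank1 v -> rank1 (A v).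
Proof.
case=> w vw; exists (D w) => u; have [u' <-] := surjA u; rewrite formA.
by case: (vw u') => ->; [left; rewrite D0 | right].
Qed.

Let A_neq0 v : v <> 0 -> A v <> 0.
Proof. by move=> nz_v; rewrite -A0 => /injA. Qed.

Let E_neq0 i : (i <= k)%N -> E i <> 0.
Proof.
by move=> lei /(congr1 (fun v => xc v i)) /eqP; rewrite xcE // eqxx xc0 oner_eq0.
Qed.
Let ones_neq0 : ones <> 0.
Proof.
by move/(congr1 (fun v => xc v 0)) => /eqP; rewrite xc_ones xc0 oner_eq0.
Qed.

Let A_Ek : A (E k) = E k.
Proof.
have := sqA (E k); rewrite sq_Ek D0 => sq0.
case: (rank1P (rank1A rank1_Ek) (A_neq0 (E_neq0 (leqnn k)))) sq0 => [->|->|->] //.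
  by rewrite sq_E0.
by rewrite sq_ones.
Qed.

(** Elements of W with third coordinate 0 are sums of commutators. This distinguishes the square of
    [E 0] from that of [ones]. *)
Let D_form w : w.2 = 0 -> (D w).2 = 0.
Proof.
have E1 : rig_form (E 0) (F 0) = (1, 0, 0).
  by rewrite /rig_form c1F // c2F // !xcE.
have E2 : rig_form (E 1) (F 0) = (0, 1, 0).
  by rewrite /rig_form c1F // c2F // !xcE.
case: w => [[w1 w2] w3] /= ->.
have -> : (w1, w2, 0) = (w1, 0, 0) + (0, w2, 0) :> W by congr (_, _, _); rewrite /= ?addr0 ?add0r.
have D1 : (D ((w1, 0, 0) : W)).2 = 0.
  by case: (F2P w1) => ->; [rewrite D0 | rewrite -E1 -formA].
have D2 : (D ((0, w2, 0) : W)).2 = 0.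
  by case: (F2P w2) => ->; [rewrite D0 | rewrite -E2 -formA].
rewrite DD; transitivity ((D ((w1, 0, 0) : W)).2 + (D ((0, w2, 0) : W)).2) => //.
by rewrite D1 D2 addr0.
Qed.

Let A_E0 : A (E 0) = E 0.
Proof.
have := sqA (E 0); rewrite sq_E0 => sq0.
have sq2 := D_form (erefl : (0, 1, 0).2 = 0).
have nz : D (0, 1, 0) <> 0 by rewrite -D0 => /injD.
case: (rank1P (rank1A rank1_E0) (A_neq0 (E_neq0 (leq0n k)))) sq0 => [->|->|->] //.
  by rewrite sq_Ek => /esym/nz.
by rewrite sq_ones => sq; rewrite -sq in sq2.
Qed.

Let A_ones : A ones = ones.
Proof.
case: (rank1P (rank1A rank1_ones) (A_neq0 ones_neq0)) => // eqA.
  have /injA/(congr1 (fun v => xc v k))/eqP : A ones = A (E 0) by rewrite A_E0.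
  by rewrite xc_ones xcE.
have /injA/(congr1 (fun v => xc v 0))/eqP : A ones = A (E k) by rewrite A_Ek.
by rewrite xc_ones xcE.
Qed.

(** Two basis vectors are squares of fixed vectors; the third, [(1, 0, 0)], is the only nonzero
    value of the form on the fixed vector [E 0]. *)
Let D_id w : D w = w.
Proof.
have D2 : D (0, 1, 0) = (0, 1, 0) by rewrite -sq_E0 -sqA A_E0.
have D3 : D (0, 0, 1) = (0, 0, 1) by rewrite -sq_ones -sqA A_ones.
have D1 : D (1, 0, 0) = (1, 0, 0).
  have E1 : rig_form (E 0) (F 0) = (1, 0, 0) by rewrite /rig_form c1F // c2F // !xcE.
  have : D (1, 0, 0) <> 0 by rewrite -D0 => /injD.
  rewrite -E1 -formA A_E0 /rig_form c1C c2C c1E // c2E0.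
  by case: (F2P (yc (A (F 0)) 0)) => ->.
case: w => [[w1 w2] w3].
have -> : (w1, w2, w3) = (w1, 0, 0) + (0, w2, 0) + (0, 0, w3) :> W.
  by congr (_, _, _); rewrite /= ?addr0 ?add0r.
rewrite !DD; congr (_ + _ + _).
- by case: (F2P w1) => ->; rewrite ?D0.
- by case: (F2P w2) => ->; rewrite ?D0.
- by case: (F2P w3) => ->; rewrite ?D0.
Qed.

Let c1A u v : c1 (A u) (A v) = c1 u v.
Proof. by have := congr1 (fun w : W => w.1.1) (formA u v); rewrite D_id. Qed.
Let c2A u v : c2 (A u) (A v) = c2 u v.
Proof. by have := congr1 (fun w : W => w.1.2) (formA u v); rewrite D_id. Qed.

(** [E j.+1] pairs under [c2] as [E j] does under [c1], and [A] preserves both forms. So the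
    X-coordinates of [A (E j.+1)] are those of [A (E j)] shifted by one, with the missing ends
    supplied by the fixed vectors [E 0] and [E k]. *)
Let chain j u : (j < k)%N -> c2 (A (E j.+1)) u = c1 (A (E j)) u.
Proof.
move=> ltj; have [v <-] := surjA u; rewrite c1A c2A c1C c2C c2E // c1E ?ltj //.
exact: ltnW.
Qed.

Let y_AE j i : (j <= k)%N -> (i < k)%N -> yc (A (E j)) i = 0.
Proof.
elim: j i => [|j IHj] i lej lti; first by rewrite A_E0 ycE.
rewrite -c2E // chain // c1E //; case: ifP => // lti1.
by rewrite IHj // ltnW.
Qed.

Let x_AE_step j i : (j < k)%N -> (i < k)%N -> xc (A (E j.+1)) i.+1 = xc (A (E j)) i.
Proof. by move=> ltj lti; rewrite -c2F // chain // c1F. Qed.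

Let x_AE_ge j i : (j <= i <= k)%N -> xc (A (E j)) i = (i == j)%:R.
Proof.
elim: j i => [|j IHj] [|i] //; first by rewrite A_E0 xcE.
  by move=> ?; rewrite A_E0 xcE.
move=> /andP[leji lti]; have ltj : (j < k)%N by apply: leq_trans lti.
by rewrite x_AE_step //; apply: IHj; rewrite -ltnS leji ltnW.
Qed.

Let x_AE_lt j i : (i < j <= k)%N -> xc (A (E j)) i = 0.
Proof.
move=> /andP[ij lej]; move: lej ij.
elim: {j}(k - j)%N {-2}j (erefl (k - j)%N) i => [|n IHn] j kj i lej ij.
  have -> : j = k by apply/eqP; rewrite eqn_leq lej -subn_eq0 kj.
  have lik : (i < k)%N by apply: leq_trans ij lej.
  by rewrite A_Ek xcE ?ltn_eqF // ltnW.
have ltj : (j < k)%N by rewrite -subn_gt0 kj.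
rewrite -x_AE_step //; last exact: ltn_trans ij ltj.
by apply: IHn => //; rewrite subnS kj.
Qed.

Let A_E j : (j <= k)%N -> A (E j) = E j.
Proof.
move=> lej; apply: rig_quotP => i lei; last by rewrite y_AE // ycE.
rewrite xcE //; case: (leqP j i) => [ji | ij]; first by rewrite x_AE_ge ?ji.
by rewrite x_AE_lt ?ij // ltn_eqF.
Qed.

Let y_AF j i : (j < k)%N -> (i < k)%N -> yc (A (F j)) i = (i == j)%:R.
Proof. by move=> ltj lti; rewrite -c2E // -(A_E lti) c2A c2E // ycF. Qed.

(** The X-part of [A (F j)], the only part still unknown. This matrix is symmetric by [c1] and
    Hankel by [c2]; the squares kill the diagonal and row 1, then row 0 and the subdiagonal
    follow. *)
Let H i j := xc (A (F j)) i.

Let A_F2 j : (j < k)%N -> (A (F j)).2 = (F j).2.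
Proof.
move=> ltj; apply/rowP=> i.
by have := y_AF ltj (ltn_ord i); rewrite -ycF // /yc inord_val.
Qed.

Let pair1F u j : (j < k)%N -> pair1 u.1 (F j).2 = xc u j.
Proof. by move=> ltj; rewrite -c1F // /c1 [in RHS]pair10l addr0. Qed.
Let pair2F u j : (j < k)%N -> pair2 u.1 (F j).2 = xc u j.+1.
Proof. by move=> ltj; rewrite -c2F // /c2 [in RHS]pair20l addr0. Qed.

Let H_sym i j : (i < k)%N -> (j < k)%N -> H i j = H j i.
Proof.
move=> lti ltj; apply: F2_addr0_eq.
have := c1A (F j) (F i); rewrite {1}/c1 !A_F2 // !pair1F // => ->.
by rewrite c1F // xcF.
Qed.

Let H_hankel i j : (i < k)%N -> (j < k)%N -> H i.+1 j = H j.+1 i.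
Proof.
move=> lti ltj; apply: F2_addr0_eq.
have := c2A (F j) (F i); rewrite {1}/c2 !A_F2 // !pair2F // => ->.
by rewrite c2F // xcF.
Qed.

Let H_sq j : (j < k)%N -> [/\ H j j = 0, H j.+1 j + (H 0 j + H 1 j) = 0 & H 1 j = 0].
Proof.
move=> ltj; have := sqA (F j).
rewrite D_id !rig_sqE A_F2 // !pair1F // !pair2F // !xcF !addr0 => sqF.
split; first exact: (congr1 (fun w : W => w.1.1) sqF).
  exact: (congr1 (fun w : W => w.1.2) sqF).
exact: (congr1 snd sqF).
Qed.

Let H_0 j : (j < k)%N -> H 0 j = 0.
Proof.
case: j => [|j] ltj; first by case: (H_sq ltj).
have ltj' : (j < k)%N by apply: ltnW.
by rewrite H_sym // -H_hankel //; case: (H_sq ltj').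
Qed.

Let H_eq0 i j : (i <= k)%N -> (j < k)%N -> H i j = 0.
Proof.
have H_ge n i' j' : (i' - j' <= n)%N -> (j' <= i' <= k)%N -> (j' < k)%N -> H i' j' = 0.
  elim/ltn_ind: n i' j' => n IHn i' j' len /andP[leji lei] ltj.
  have [Hd Hs H1] := H_sq ltj.
  have [-> // | neq_ij] := eqVneq i' j'.
  have [-> | neq_ij1] := eqVneq i' j'.+1.
    by move: Hs; rewrite H1 H_0 // !addr0.
  case: i' => [|i'] in len leji lei neq_ij neq_ij1 *; first by lia.
  (* The Hankel and symmetry relations together pass from [(i'.+1, j')] to [(i', j'.+1)], which is
     two steps closer to the diagonal. *)
  rewrite H_hankel; [rewrite H_sym; try lia | lia | lia].
  by apply: (IHn (i' - j'.+1)%N); lia.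
move=> lei ltj; case: (leqP j i) => [ji | ij]; first by apply: (H_ge (i - j)%N); lia.
by rewrite H_sym; [apply: (H_ge (j - i)%N) | |]; lia.
Qed.

Let A_F j : (j < k)%N -> A (F j) = F j.
Proof.
move=> ltj; apply: rig_quotP => i lei; first by rewrite [LHS]H_eq0 // xcF.
by rewrite /yc A_F2.
Qed.

Lemma rig_isometry_id v : A v = v.
Proof.
have A_sum n (G : 'I_n -> V) (a : 'I_n -> 'F_2) : (forall i, A (G i) = G i) ->
    A (\sum_i G i *+ a i) = \sum_i G i *+ a i.
  move=> AG; rewrite (big_morph _ AD A0); apply: eq_bigr => i _.
  by case: (F2P (a i)) => ->; rewrite ?mulr0n ?mulr1n.
have -> : v = \sum_(i < m.+3) E i *+ v.1 0 i + \sum_(j < m.+2) F j *+ v.2 0 j.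
  have E_sum n (G : 'I_n -> V) : \sum_i G i = (\sum_i (G i).1, \sum_i (G i).2).
    by apply: injective_projections; [rewrite /= (big_morph fst (id1 := 0) (op1 := +%R)) | rewrite /= (big_morph snd (id1 := 0) (op1 := +%R))].
  have scal n' (a : 'F_2) (x : 'rV['F_2]_n') : x *+ a = a *: x.
    by case: (F2P a) => ->; rewrite ?scale0r ?scale1r ?mulr0n ?mulr1n.
  rewrite !E_sum; case: v => x y; congr (_, _) => /=.
    rewrite [X in _ + X]big1 ?addr0 => [|i _]; last by case: (F2P (y 0 i)) => ->; rewrite ?mulr0n ?mulr1n.
    rewrite [LHS]row_sum_delta; apply: eq_bigr => i _.
    by rewrite -scal; case: (F2P (x 0 i)) => ->; rewrite ?mulr0n ?mulr1n //= inord_val.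
  rewrite [X in X + _]big1 ?add0r => [|i _]; last by case: (F2P (x 0 i)) => ->; rewrite ?mulr0n ?mulr1n.
  rewrite [LHS]row_sum_delta; apply: eq_bigr => i _.
  by rewrite -scal; case: (F2P (y 0 i)) => ->; rewrite ?mulr0n ?mulr1n //= inord_val.
by rewrite AD !A_sum // => i; [apply: A_F | apply: A_E; rewrite -ltnS].
Qed.

End Isometry.

Lemma rig_central (z : rig) : (forall h : rig, (z * h = h * z)%g) -> z.1 = 0.
Proof.
move=> cz; apply: rig_form_nondeg => v.
have := congr1 snd (cz (v, 0)); rewrite !rigM /= addr0 add0r rig_formE => /addrI.
by rewrite -[X in _ = X -> _]addr0 => /addrI.
Qed.

(** * Automorphisms of the extension *)

Section Automorphism.

Variable a : {perm rig}.
Hypothesis Aut_a : a \in Aut [set: rig].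

Let aM g h : a (g * h)%g = (a g * a h)%g.
Proof. exact: (morphicP (Aut_morphic Aut_a)). Qed.

Let a_center w : (a (0, w)).1 = 0.
Proof.
apply: rig_central => h; rewrite -(permKV a h) -!aM; congr (a _).
by rewrite !rigM /= rig_cocycle0l rig_cocycle0r addrC [w + _]addrC.
Qed.

Lemma rig_Aut_center w : a (0, w) = (0, (a (0, w)).2).
Proof. by rewrite [LHS]surjective_pairing a_center. Qed.

End Automorphism.

(** An automorphism induces [A] on V and [D] on W, and [b_compat] says that they respect [b] up to
    the coboundary of [v |-> (a (v, 0)).2]. A coboundary is symmetric and here vanishes on the
    diagonal, so [A] and [D] respect the form and the squares exactly. *)
Lemma rig_Aut_fst (a : {perm rig}) (g : rig) : a \in Aut [set: rig] -> (a g).1 = g.1.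
Proof.
move=> Aa; have aM h h' : a (h * h')%g = (a h * a h')%g.
  exact: (morphicP (Aut_morphic Aa)).
pose A v := (a (v, 0)).1; pose D w := (a (0, w)).2.
have a0w w : a (0, w) = (0, D w) by exact: rig_Aut_center.
have splitg v w : (v, w) = (((v, 0) : rig) * ((0, w) : rig))%g.
  by rewrite rigM /= rig_cocycle0r !addr0 add0r.
have a_fst v w : (a (v, w)).1 = A v.
  by rewrite splitg aM rigM a0w /= addr0.
have a_snd v w : (a (v, w)).2 = (a (v, 0)).2 + D w.
  by rewrite splitg aM rigM a0w /= rig_cocycle0r addr0.
have AD u v : A (u + v) = A u + A v.
  transitivity (a (((u, 0) : rig) * ((v, 0) : rig))%g).1; last by rewrite aM rigM.
  by rewrite rigM /= a_fst.
have DD w w' : D (w + w') = D w + D w'.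
  have := congr1 snd (aM (0, w) (0, w')).
  by rewrite !rigM !a0w /= !rig_cocycle0l !addr0 a0w.
have D0 : D 0 = 0 by apply: (addrI (D 0)); rewrite -DD !addr0.
have injD : injective D.
  by move=> w w' eqD; have [] : (0, w) = (0, w') :> rig by apply: (@perm_inj _ a); rewrite !a0w eqD.
have injA : injective A.
  move=> u v eqA; have Aa' : (a^-1)%g \in Aut [set: rig] by rewrite groupV.
  have : (a (u, 0)) = (a (v, 0) * (0, (a (u, 0)).2 - (a (v, 0)).2))%g.
    rewrite rigM /= rig_cocycle0r !addr0 addrC subrK -/(A v) -eqA.
    exact: surjective_pairing.
  move/(congr1 (a^-1)%g); rewrite permK (morphicP (Aut_morphic Aa')) ?inE // permK.
  by rewrite (rig_Aut_center Aa') rigM /= addr0 => -[].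
have b_compat u v : b (A u) (A v) + ((a (u, 0)).2 + (a (v, 0)).2)
    = D (b u v) + (a (u + v, 0)).2.
  have := congr1 snd (aM (u, 0) (v, 0)).
  by rewrite !rigM /= !add0r a_snd [X in _ -> X = _]addrC [in X in _ -> _ = X]addrC => ->.
have formA u v : rig_form (A u) (A v) = D (rig_form u v).
  have := b_compat u v; rewrite rig_formE [b u v]rig_formE DD.
  have := b_compat v u; rewrite [v + u]addrC [(a (v, 0)).2 + _]addrC.
  move=> eqb; rewrite [b (A v) (A u) + _]addrC -addrA eqb addrA [D (b v u) + _]addrC.
  by rewrite -!addrA => /addIr.
have sqA v : b (A v) (A v) = D (b v v).
  have := b_compat v v.
  have addWW (w : W) : w + w = 0 by case: w => [[? ?] ?]; congr (_, _, _); apply: F2_addrr.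
  have addVV (u : V) : u + u = 0.
    by case: u => [x y]; congr (_, _); apply/rowP=> i; rewrite !mxE F2_addrr.
  rewrite addWW addVV addr0 => ->.
  by rewrite a0w /= D0 addr0.
case: g => v w; rewrite a_fst.
exact: (rig_isometry_id AD injA D0 DD injD formA sqA).
Qed.

(** The central automorphism adding the linear map [xc _ 0] times [w]. At [E 0] these reach the
    whole coset of W. *)
Lemma rig_shift_Aut (w : W) (u : V) :
  (u, w *+ xc u 0) \in orbit 'P%act (Aut [set: rig]) ((u, 0) : rig).
Proof.
pose f (g : rig) : rig := (g.1, g.2 + w *+ xc g.1 0).
have addWW (w' : W) : w' + w' = 0 by case: w' => [[? ?] ?]; congr (_, _, _); apply: F2_addrr.
have fM : {in [set: rig] &, {morph f : g h / (g * h)%g}}.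
  move=> g h _ _; rewrite !rigM /f /=; congr (_, _).
  have -> : w *+ xc (g.1 + h.1) 0 = w *+ xc g.1 0 + w *+ xc h.1 0.
    have -> : xc (g.1 + h.1) 0 = xc g.1 0 + xc h.1 0 by rewrite /xc mxE.
    case: (F2P (xc g.1 0)) => ->; case: (F2P (xc h.1 0)) => ->;
      by rewrite ?addr0 ?add0r ?mulr0n ?addr0 ?add0r // addWW.
  by rewrite !addrA [LHS](ACl (1*4*2*5*3)).
have injf : injective f.
  move=> [v x] [v' x'] fE; have /= vE := congr1 fst fE.
  by have := congr1 snd fE; rewrite /= vE => /addIr ->.
have injm_f : ('injm (Morphism fM))%g by apply/injmP => g h _ _; apply: injf.
have -> : (u, w *+ xc u 0) = Morphism fM ((u, 0) : rig) by rewrite /= /f add0r.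
apply: mem_Aut_orbit; rewrite ?inE //.
by apply/eqP; rewrite eqEcard subsetT (card_injm injm_f) ?leqnn.
Qed.

Lemma card_rig_center : #|{: W}| = 8%N.
Proof. by rewrite !card_prod !card_ord. Qed.

Lemma maol_rig : maol [set: rig] = 8%N.
Proof.
apply/eqP; rewrite eqn_leq; apply/andP; split.
  apply/maol_leqP => g _; rewrite -card_rig_center.
  rewrite -(card_imset _ (fun w w' (e : (g.1, w) = (g.1, w') :> rig) => congr1 snd e)).
  apply/subset_leq_card/subsetP => h /orbitP[a Aa <-].
  apply/imsetP; exists (a g).2; rewrite ?inE //.
  by rewrite -(rig_Aut_fst g Aa); apply: surjective_pairing.
apply: leq_trans (leq_bigmax_cond (P := mem [set: rig]) _ (in_setT ((E 0, 0) : rig))).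
rewrite -card_rig_center.
rewrite -(card_imset _ (fun w w' (e : (E 0, w) = (E 0, w') :> rig) => congr1 snd e)).
apply/subset_leq_card/subsetP => _ /imsetP[w _ ->].
by have := rig_shift_Aut w (E 0); rewrite xcE // mulr1n.
Qed.

Lemma card_rig : #|[set: rig]| = (2 ^ (m.+3 + m.+2 + 3))%N.
Proof.
rewrite cardsT card_prod card_rig_center card_prod !card_mx card_Fp //.
by rewrite !mul1n [RHS]expnD expnD.
Qed.

End Rigid.

Lemma infinite_2groups_maol8 :
  infinitely_many_up_to_isog
    (fun (gT : finGroupType) (G : {group gT}) => (2.-group G)%g /\ maol G = 8%N).
Proof.
case=> n [hT [H isoH]]; pose m := \max_(i < n) #|H i|.
have [|i] := isoH _ [set: rig m]%G.
  by rewrite /= /pgroup card_rig pnatX pnat_id ?orbT ?maol_rig.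
move/card_isog; rewrite card_rig => cardH.
have : (#|H i| <= m)%N by exact: leq_bigmax.
rewrite -cardH leqNgt; case/negP.
apply: leq_trans (ltn_expl _ (ltnSn 1)) _.
by rewrite leq_exp2l // -addnA (leq_trans _ (leq_addr _ _)) // -addn3 leq_addr.
Qed.

(** * Bounding the order by maol and the number of generators *)

Section Bounded.

Local Open Scope nat_scope.
Local Open Scope group_scope.

(** Units modulo a divisor lift to units. With [t] the part of [n] at primes dividing neither [o]
    nor [k], each prime divisor of [n] divides exactly one of [k] and [o * t]. *)
Lemma coprime_lift (n k o : nat) : 0 < n -> o %| n -> coprime k o ->
  exists k', k' = k %[mod o] /\ coprime k' n.
Proof.
move=> n0 on cko; pose t := partn n [pred p | ~~ (p %| o * k)].
exists (k + o * t); split; first by rewrite addnC mulnC modnMDl.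
set g := gcdn (k + o * t) n; apply: contraT => g1.
have p_pr : prime (pdiv g) by rewrite pdiv_prime // ltn_neqAle eq_sym g1 gcdn_gt0 n0 orbT.
set p := pdiv g in p_pr *.
have pg : p %| g := pdiv_dvd g.
have pk : p %| k + o * t := dvdn_trans pg (dvdn_gcdl _ _).
have pn : p %| n := dvdn_trans pg (dvdn_gcdr _ _).
have Npi pi : p %| partn n pi -> p \in pi by move/pnat_dvd/(_ (part_pnat pi n)); rewrite pnatE.
have [pok | pok] := boolP (p %| o * k).
  have pt : ~~ (p %| t) by apply/negP=> /Npi; rewrite inE pok.
  have [po | po] := boolP (p %| o).
    have : p %| gcdn k o by rewrite dvdn_gcd po -(dvdn_addl _ (dvdn_mulr t po)) pk.
    by rewrite (eqP cko) dvdn1 => /eqP p1; rewrite p1 in p_pr.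
  move: pok; rewrite Euclid_dvdM // (negPf po) /= => pk'.
  by move: pk; rewrite dvdn_addr // Euclid_dvdM // (negPf po) (negPf pt).
have pt : p %| t.
  move: pn; rewrite -(partnC [pred p | ~~ (p %| o * k)] n0) Euclid_dvdM // => /orP[//|].
  by move/Npi; rewrite !inE negbK (negPf pok).
by move: pk; rewrite dvdn_addl ?(dvdn_mull o pt) // => /(dvdn_mull o); rewrite (negPf pok).
Qed.

(* The transfer [f] of [G] into its center sends a central [z] to its power of
   exponent [#|G : 'Z(G)|], and [x |-> x * f x ^+ m] is an automorphism. *)
Lemma central_expg_Aut_orbit (gT : finGroupType) (G : {group gT}) (m : nat) (z : gT) :
  coprime (1 + #|G : 'Z(G)| * m) #|G| -> z \in 'Z(G) ->
  z ^+ (1 + #|G : 'Z(G)| * m) \in orbit 'P%act (Aut G) z.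
Proof.
move=> co_m Zz.
have [f [fZ fE]] := transfer_expg (center_sub G) (center_abelian G).
have {}fZ x : x \in G -> f x \in 'Z(G).
  by move=> Gx; rewrite (subsetP fZ) // mem_morphim.
have {}fE x : x \in 'Z(G) -> f x = x ^+ #|G : 'Z(G)|.
  move=> Zx; apply: fE => // k g Gg _; apply/conjg_fixP/commgP/commute_sym/commuteX.
  by case/setIP: Zx => _ /centP/(_ g Gg)/commute_sym.
have aM : {in G &, {morph (fun x => x * f x ^+ m) : x y / x * y}}.
  move=> x y Gx Gy; have cy : commute (f x ^+ m) y.
    apply/commute_sym/commuteX/commute_sym.
    by case/setIP: (fZ x Gx) => _ /centP/(_ y Gy).
  have cf : commute (f x) (f y).
    by case/setIP: (fZ x Gx) => _ /centP; apply; case/setIP: (fZ y Gy).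
  by rewrite morphM // expgMn // -!mulgA; congr (_ * _); rewrite !mulgA cy.
pose a := Morphism aM; have aE x : a x = x * f x ^+ m by [].
have inja : 'injm a.
  apply/subsetP=> x /morphpreP[Gx /set1P]; rewrite aE => ax1.
  have Zx : x \in 'Z(G).
    have /eqP := ax1; rewrite mulg_eq1 => /eqP ->.
    by rewrite groupV groupX ?fZ.
  move: ax1; rewrite fE // -expgM -{1}(expg1 x) -expgD => /eqP.
  rewrite -order_dvdn => ox; rewrite inE -order_eq1 -dvdn1 -(eqP co_m).
  by rewrite dvdn_gcd ox order_dvdG.
have ima : a @* G = G.
  apply/eqP; rewrite eqEcard card_injm // leqnn andbT.
  apply/subsetP=> _ /morphimP[x _ Gx ->]; rewrite aE groupM ?groupX //.
  by rewrite (subsetP (center_sub G)) ?fZ.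
have Gz := subsetP (center_sub G) z Zz.
by have := mem_Aut_orbit inja ima Gz; rewrite aE fE // -expgM expgD expg1.
Qed.

(** Lift the units modulo the order of [z] to units modulo [#|G|] and color them by residue modulo
    n. Dividing by one fixed lift makes all exponents of a color congruent to 1 modulo n, so they
    give distinct points of the orbit of [z]. *)
Lemma totient_central (gT : finGroupType) (G : {group gT}) (c : nat) (z : gT) :
  maol G <= c -> z \in 'Z(G) -> totient #[z] <= c * #|G : 'Z(G)|.
Proof.
move=> maolG Zz; set n := #|G : 'Z(G)|; set o := #[z].
have Gz := subsetP (center_sub G) z Zz.
have nG : n %| #|G| := dvdn_indexg _ _.
have n0 : 0 < n := indexg_gt0 _ _.
have oG : o %| #|G| := order_dvdG Gz.
have o0 : 0 < o := order_gt0 z.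
pose U := [set k : 'I_o | coprime o k].
have -> : totient o = #|U|.
  by rewrite totient_count_coprime big_mkord -sum1dep_card [RHS]big_mkcond.
have /fin_all_exists[L LP] (k : 'I_o) :
    exists k', k \in U -> k' = k %[mod o] /\ coprime k' #|G|.
  have [Uk | _] := boolP (k \in U); last by exists 0%N.
  rewrite inE coprime_sym in Uk.
  by have [k' k'P] := coprime_lift (cardG_gt0 G) oG Uk; exists k'.
pose color k := Ordinal (ltn_pmod (L k) n0).
rewrite -sum1_card (partition_big color xpredT) //= mulnC.
apply: leq_trans (_ : \sum_(i < n) c <= _); last by rewrite sum_nat_const card_ord.
rewrite leq_sum // => i _.
rewrite sum1dep_card; set W := [set k | _].
have [-> | [k0 Wk0]] := set_0Vmem W; first by rewrite cards0.
have /andP[Uk0 /eqP ck0] : (k0 \in U) && (color k0 == i) by rewrite inE in Wk0.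
have [_ coL0] := LP k0 Uk0.
pose j := (L k0 ^ (totient #|G|).-1)%N.
have jL : (L k0 * j = 1 %[mod #|G|])%N.
  by rewrite -expnS prednK ?totient_gt0 ?cardG_gt0 // Euler_exp_totient.
have coj : coprime j #|G| by rewrite coprimeXl.
have zL k : k \in U -> (z ^+ (L k * j)) ^+ L k0 = z ^+ k.
  move=> Uk; have [Lk _] := LP k Uk; apply/eqP.
  rewrite -expgM eq_expg_mod_order -mulnA (mulnC j) -modnMm Lk.
  by rewrite -[X in (_ * X)%N](modn_dvdm _ oG) jL (modn_dvdm _ oG) modnMm muln1.
have injW : {in W &, injective (fun k => z ^+ (L k * j))}.
  move=> k l; rewrite !inE => /andP[Uk _] /andP[Ul _] /(congr1 (fun x => x ^+ L k0)).
  have Uk' : k \in U by rewrite inE. have Ul' : l \in U by rewrite inE.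
  rewrite /= !zL // => /eqP; rewrite eq_expg_mod_order !modn_small // => /eqP.
  exact: val_inj.
rewrite -(card_in_imset injW); apply: leq_trans (maol_leqP _ _ maolG z Gz).
apply/subset_leq_card/subsetP=> _ /imsetP[k Wk ->].
have /andP[Uk /eqP ck] : (k \in U) && (color k == i) by rewrite inE in Wk.
have [_ coL] := LP k Uk.
have Lkn : L k = L k0 %[mod n] by have := congr1 val ck; rewrite -ck0.
(* Adding [#|G|] preserves both [z ^+ K] and the residue modulo n, and makes [K] positive so that
   [K.-1] is a true predecessor. *)
pose K := (L k * j + #|G|)%N.
have zK : z ^+ K = z ^+ (L k * j) by rewrite expgD expg_cardG // mulg1.
have K0 : 0 < K by rewrite addn_gt0 cardG_gt0 orbT.
have Kn : (K = 1 %[mod n])%N.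
  rewrite -modnDmr (eqP nG) addn0 -modnMml Lkn modnMml.
  by rewrite -(modn_dvdm _ nG) jL modn_dvdm.
have KE : K = (1 + n * (K.-1 %/ n))%N.
  rewrite mulnC divnK ?add1n ?prednK //.
  by rewrite -subn1 -eqn_mod_dvd //; apply/eqP.
rewrite -zK KE; apply: central_expg_Aut_orbit => //; rewrite -/n -KE.
by rewrite /K coprime_sym -coprime_modr modnDr coprime_modr coprime_sym coprimeMl coL.
Qed.

Lemma indexgI_leq (gT : finGroupType) (G H K : {group gT}) : H \subset G ->
  #|G : H :&: K| <= #|G : H| * #|G : K|.
Proof.
move=> sHG; rewrite -(Lagrange_index sHG (subsetIl H K)) indexgI leq_mul2l.
by apply/orP; right; apply: subset_leq_card; apply: imsetS.
Qed.

Lemma index_centI (gT : finGroupType) (G : {group gT}) (c : nat) (A : {set gT}) :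
  {in A, forall x, #|G : 'C_G[x]| <= c} -> #|G : 'C_G(A)| <= c ^ #|A|.
Proof.
have [m] := ubnP #|A|; elim: m A => // m IHm A; rewrite ltnS => leAm cA.
have [-> | [x Ax]] := set_0Vmem A.
  by rewrite cards0 -cent_gen gen0 cent1T setIT indexgg.
rewrite -(setD1K Ax) centU cardsU1 !inE eqxx /= add1n expnS.
rewrite cent_set1 setIIr.
apply: leq_trans (indexgI_leq _ _) _; first exact: subsetIl.
rewrite leq_mul ?cA // IHm //; first by rewrite (cardsD1 x) Ax in leAm.
by move=> y /setD1P[_]; apply: cA.
Qed.

Lemma card_mulg_leq (gT : finGroupType) (A B : {set gT}) : #|A * B| <= #|A| * #|B|.
Proof. by rewrite -cardsX /mulg /= /set_mulg curry_imset2X leq_imset_card. Qed.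

Lemma card_abelian_gen (gT : finGroupType) (A : {set gT}) (e : nat) :
  abelian <<A>> -> {in A, forall x, #[x] <= e} -> #|<<A>>| <= e ^ #|A|.
Proof.
have [m] := ubnP #|A|; elim: m A => // m IHm A; rewrite ltnS => leAm abA oA.
have [-> | [x Ax]] := set_0Vmem A; first by rewrite gen0 cards1 cards0.
rewrite -(setD1K Ax) cardsU1 !inE eqxx /= add1n expnS.
have sBA : <<A :\ x>> \subset <<A>> by rewrite genS ?subD1set.
rewrite -[<<_ |: _>>]/([set x] <*> (A :\ x)) -joing_idr -joing_idl norm_joinEl; last first.
  by apply: subset_trans (sub_abelian_norm abA sBA); rewrite cycle_subG mem_gen.
apply: leq_trans (card_mulg_leq _ _) _.
rewrite leq_mul ?oA // IHm ?(abelianS sBA) //; first by rewrite (cardsD1 x) Ax in leAm.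
by move=> y /setD1P[_]; apply: oA.
Qed.

(* Schreier's generators *)
Lemma card_leq_center_gen (gT : finGroupType) (G : {group gT}) (S : {set gT}) (e : nat) :
  <<S>> = G -> {in 'Z(G), forall z, #[z] <= e} ->
  #|G| <= #|G : 'Z(G)| * e ^ (#|G : 'Z(G)| * #|S|).
Proof.
move=> defG oZ.
pose r g := repr ('Z(G) :* g); pose T := r @: G.
have nT : #|T| <= #|G : 'Z(G)|.
  have -> : T = repr @: rcosets 'Z(G) G 
    by rewrite /rcosets -imset_comp; apply: eq_imset => g; rewrite /= rcosetE.
  exact: leq_imset_card.
have rZ' g : r g \in 'Z(G) :* g by apply: mem_repr (rcoset_refl _ _).
have rZ g : g * (r g)^-1 \in 'Z(G) by rewrite -groupV invMg invgK -mem_rcoset.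
have rG g : g \in G -> r g \in G.
  move=> Gg; have := rZ' g; rewrite mem_rcoset => /(subsetP (center_sub G)).
  by rewrite groupMr ?groupV.
pose u ts := ts.1 * ts.2 * (r (ts.1 * ts.2))^-1.
pose A := u @: setX T S.
have sAZ : A \subset 'Z(G) by apply/subsetP=> _ /imsetP[ts _ ->]; apply: rZ.
have cA : #|A| <= #|G : 'Z(G)| * #|S|.
  by apply: leq_trans (leq_imset_card _ _) _; rewrite cardsX leq_mul2r nT orbT.
have HZ : <<A>> \subset 'Z(G) by rewrite gen_subG.
have abA : abelian <<A>> := abelianS HZ (center_abelian G).
have sTG : T \subset G by apply/subsetP=> _ /imsetP[g Gg ->]; apply: rG.
(* The elements mapping [<<A>> * T] into itself by right multiplication are closed under products,
   hence form a group by finiteness; as it contains [S], it is all of [G]. *)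
pose X := [set g in G | <<A>> * T :* g \subset <<A>> * T].
have gX : group_set X.
  apply/group_setP; split=> [|g h]; rewrite !inE ?group1 ?mulg1 ?subxx //.
  move=> /andP[Gg Xg] /andP[Gh Xh]; rewrite groupM //= rcosetM.
  by apply: subset_trans Xh; rewrite mulSg.
have sGX : G \subset Group gX.
  rewrite -defG gen_subG; apply/subsetP=> s Ss.
  have Gs : s \in G by rewrite -defG mem_gen.
  rewrite !inE Gs; apply/subsetP=> _ /rcosetP[_ /mulsgP[h t Hh Tt ->] ->].
  have -> : h * t * s = h * u (t, s) * r (t * s) by rewrite /u /= !mulgA mulgKV.
  rewrite mem_mulg //; last by rewrite imset_f // groupM // (subsetP sTG).
  by rewrite groupM // mem_gen // imset_f // inE Tt.
have sGHT : G \subset <<A>> * T.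
  apply/subsetP=> g Gg; pose t := r 1; have Tt : t \in T by apply: imset_f.
  have Gt := subsetP sTG t Tt.
  have : t^-1 * g \in Group gX by rewrite (subsetP sGX) ?groupM ?groupV.
  case/setIdP=> _ /subsetP/(_ g); apply.
  by rewrite mem_rcoset invMg invgK mulgA mulgV mul1g -[t]mul1g mem_mulg.
apply: leq_trans (subset_leq_card sGHT) _.
apply: leq_trans (card_mulg_leq _ _) _; rewrite mulnC leq_mul //.
apply: leq_trans (card_abelian_gen (e := e) abA _) _.
  by move=> a Aa; apply: oZ; apply: (subsetP sAZ).
rewrite leq_pexp2l //; apply: leq_trans (oZ 1 (group1 _)); by rewrite order1.
Qed.

(** The center is the intersection of the centralizers of the generators, hence the index [c ^ d].
    The base of the power is twice the square of [c * c ^ d], which bounds the totients of central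
    orders. *)
Lemma d_generated_card (gT : finGroupType) (G : {group gT}) (c d : nat) :
  0 < c -> d_generated d G -> maol G <= c ->
  #|G| <= c ^ d * (2 * c ^ (2 * d.+1)) ^ (c ^ d * d).
Proof.
move=> c0 [S cS defG] maolG.
have nZ : #|G : 'Z(G)| <= c ^ d.
  rewrite /center -[in 'C(G)]defG cent_gen.
  apply: leq_trans (index_centI (c := c) _) _; last by rewrite leq_pexp2l.
  by move=> x Sx; apply: index_cent1_maol; rewrite // -defG mem_gen.
have oZ : {in 'Z(G), forall z, #[z] <= 2 * c ^ (2 * d.+1)}.
  move=> z Zz; apply: leq_trans (leq_totient_sqr (order_gt0 z)) _.
  rewrite leq_mul2l mulnC expnM leq_exp2r //= expnS.
  by apply: leq_trans (totient_central maolG Zz) _; rewrite leq_mul2l nZ orbT.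
apply: leq_trans (card_leq_center_gen defG oZ) _.
rewrite leq_mul // leq_pexp2l ?muln_gt0 ?expn_gt0 ?c0 //.
by rewrite leq_mul.
Qed.

End Bounded.

(** * Comparison with the stated logarithmic bound *)

Section LogBound.

Import Num.Theory Order.TTheory.

Variable R : realType.

Lemma ln2_gt0 : 0 < ln (2 : R).
Proof. by rewrite ln_gt0 // ltr1n. Qed.

Lemma ln2_le1 : ln (2 : R) <= 1.
Proof. by have -> : (2 : R) = 1 + 1 by []; apply: le_ln1Dx; lra. Qed.

Lemma ln_natX (n k : nat) : (0 < n)%N -> ln ((n ^ k)%:R : R) = k%:R * ln n%:R.
Proof. by move=> n0; rewrite natrX lnXn ?ltr0n // mulr_natl. Qed.

Lemma ln_nat_ge0 (n : nat) : (0 < n)%N -> 0 <= ln (n%:R : R).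
Proof. by move=> n0; rewrite ln_ge0 // ler1n. Qed.

(** For [c] at least 2 the inner sum is at least [7/2 * d], because [ln c >= ln 2], and its factor
    is at least [7/2]; so the exponent comfortably exceeds [5 * d]. For [c = 1] both logarithms
    vanish. *)
Lemma Abound_bounds (c d : nat) : (0 < c)%N ->
  (c ^ d)%:R <= Abound R c d /\ 5 * d%:R * ln c%:R <= ln (Abound R c d).
Proof.
move=> c0; have L0 := ln_nat_ge0 c0; have l0 := ln2_gt0.
rewrite /Abound; set L := ln c%:R in L0 *; set l := ln 2 in l0 *.
set B : R := 'C(d, 2)%:R; have B0 : 0 <= B by rewrite ler0n.
set D : R := d%:R; have D0 : 0 <= D by rewrite ler0n.
set Q := D / (2 * l) * ((7 + L) * L).
have Q0 : 0 <= Q by rewrite mulr_ge0 ?divr_ge0 //; nra.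
have P0 : 0 <= 2^-1 * (7 + L) * (B + Q) by rewrite mulr_ge0 //; lra.
split.
  rewrite natrX -powR_mulrn ?ler0n //; apply: ler_powR; rewrite ?ler1n //; lra.
rewrite ln_powR -/L.
have [c1 | c1] := eqVneq c 1%N.
  have -> : L = 0 by rewrite /L c1 ln1.
  by rewrite !mulr0.
have lL : l <= L.
  by rewrite ler_ln ?posrE ?ltr0n // ler_nat; lia.
have Q7 : 7 / 2 * D <= Q.
  have -> : 7 / 2 * D = D / (2 * l) * (7 * l) by field; rewrite gt_eqF.
  by rewrite ler_wpM2l ?divr_ge0 //; nra.
apply: ler_wpM2r => //.
have : 2^-1 * 7 * Q <= 2^-1 * (7 + L) * (B + Q) by apply: ler_pM; lra.
lra.
Qed.

Lemma ln_bound (n c d : nat) : (0 < n)%N -> (0 < c)%N ->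
  (n <= c ^ d * (2 * c ^ (2 * d.+1)) ^ (c ^ d * d))%N ->
  ln (n%:R : R) <=
    (1 + 1624 / 10 ^+ 5) * d%:R * (Abound R c d + 1) * (ln (Abound R c d) / ln 2 + 1)
      + 2^-1 * (7 + ln c%:R) * ln c%:R.
Proof.
move=> n0 c0 le_n.
have [A1 A2] := Abound_bounds d c0.
have L0 := ln_nat_ge0 c0; have l0 := ln2_gt0; have l1 := ln2_le1.
have cd0 : (0 < c ^ d)%N by rewrite expn_gt0 c0.
have e0 : (0 < 2 * c ^ (2 * d.+1))%N by rewrite muln_gt0 expn_gt0 c0.
have : ln (n%:R : R) <= d%:R * ln c%:R + (c ^ d)%:R * d%:R * (ln 2 + (2 * d%:R + 2) * ln c%:R).
  apply: le_trans (_ : ln ((c ^ d * (2 * c ^ (2 * d.+1)) ^ (c ^ d * d))%N%:R) <= _).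
    by rewrite ler_ln ?posrE ?ltr0n ?muln_gt0 ?cd0 ?expn_gt0 ?e0 // ler_nat.
  rewrite natrM lnM ?posrE ?ltr0n ?expn_gt0 ?c0 ?e0 //.
  have lnE : ln ((2 * c ^ (2 * d.+1))%:R : R) = ln 2 + (2 * d%:R + 2) * ln c%:R.
    rewrite natrM lnM ?posrE ?ltr0n ?expn_gt0 ?c0 // ln_natX // natrM -addn1 natrD.
    by congr (_ + _); ring.
  by rewrite !ln_natX // lnE natrM.
set a := Abound R c d in A1 A2 *; set L := ln c%:R in L0 A2 *; set l := ln 2 in l0 l1 *.
set x := ln a in A2 *; set C : R := (c ^ d)%:R in A1 *.
have C1 : 1 <= C by rewrite ler1n.
set D : R := d%:R in A2 *; have D0 : 0 <= D by rewrite ler0n.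
have DL0 : 0 <= D * L by apply: mulr_ge0.
have DD : D <= D * D.
  by rewrite -natrM ler_nat; case: (d) => // k; rewrite leq_pmulr.
have xl : 5 * D * L <= x / l by rewrite ler_pdivlMr //; nra.
set y := x / l in xl *.
move=> le1; apply: le_trans le1 _.
have DC0 : 0 <= D * C by rewrite mulr_ge0 //; lra.
have step1 : D * C * (5 * D * L + 1) <= D * a * (y + 1).
  apply: ler_pM => //; first by nra.
    by apply: ler_wpM2l.
  by lra.
have step2 : D * a * (y + 1) <= (1 + 1624 / 10 ^+ 5) * D * (a + 1) * (y + 1).
  have y0 : 0 <= y + 1 by nra.
  apply: ler_wpM2r => //; nra.
have step3 : D * L + C * D * (l + (2 * D + 2) * L) <= D * C * (5 * D * L + 1).
  have h1 : 0 <= D * C * (1 - l) by rewrite mulr_ge0 // subr_ge0.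
  (* Source of the 5: after removing [D * L], the claim is [1 + (2 * D + 2) * C <= 5 * D * C], sharp
     at [D = C = 1]. *)
  have h2 : 0 <= D * L * (C * (3 * D - 2) - 1).
    case: (posnP d) => [d0 | d0]; first by rewrite /D d0 !mul0r.
    have D1 : 1 <= D by rewrite ler1n.
    rewrite mulr_ge0 //; nra.
  lra.
have : 0 <= 2^-1 * (7 + L) * L by rewrite !mulr_ge0 //; lra.
lra.
Qed.

End LogBound.

(** * Class sizes at most 23 *)

Section ClassSizes.

Local Open Scope nat_scope.

(** The numbers up to 23 with at least two prime divisors. By Burnside, nontrivial classes of a
    nonabelian simple group do not have prime power size. *)
Definition small_sizes : seq nat := [:: 6; 10; 12; 14; 15; 18; 20; 21; 22].

Lemma small_size_bounds k i : k \in [:: 15; 21] -> 0 < i -> k * i <= 23 -> i = 1.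
Proof. by rewrite !inE => /orP[]/eqP->; lia. Qed.

Lemma small_size_odd a b i :
  a \in small_sizes -> b \in [:: 15; 21] -> a * i = b -> i = 1.
Proof. by rewrite !inE => /or4P[||| /or4P[||| /or3P[]]] /eqP-> /orP[]/eqP->; lia. Qed.

(** [n] is 3, 5 or 7, and an odd prime dividing [n - 1] can only be 3, with [n = 7] and [k = 21]. In
    use, [n] counts Sylow subgroups and [k] is the class size of an involution. *)
Lemma Sylow_count_odd k n m p : k \in [:: 15; 21] -> n * m = k -> 1 < n -> 1 < m ->
  prime p -> p != 2 -> n = 1 %[mod p] -> p %| k.
Proof.
move=> k_in nm n1 m1 p_pr p2 /eqP; rewrite eqn_mod_dvd ?(ltnW n1) // => p_n.
have : n \in [:: 3; 5; 7].
  have nk : n \in divisors k by rewrite -dvdn_divisors -nm ?dvdn_mulr ?muln_gt0 1?ltnW // ltnW.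
  have n_neq_k : n != k by rewrite -nm -{1}[n]muln1 eqn_pmul2l ?(ltnW n1) // ltn_eqF.
  move: k_in nk n_neq_k n1; rewrite !inE => /orP[]/eqP->.
    by rewrite -[divisors 15]/[:: 1; 3; 5; 15] !inE => /or4P[]/eqP->.
  by rewrite -[divisors 21]/[:: 1; 3; 7; 21] !inE => /or4P[]/eqP->.
move: p_n; rewrite !inE => p_n /or3P[]/eqP nE; rewrite {}nE in p_n nm.
- have : p \in primes (3 - 1) by rewrite mem_primes p_pr p_n.
  by rewrite -[primes _]/[:: 2] inE (negPf p2).
- have : p \in primes (5 - 1) by rewrite mem_primes p_pr p_n.
  by rewrite -[primes _]/[:: 2] inE (negPf p2).
have : p \in primes (7 - 1) by rewrite mem_primes p_pr p_n.
rewrite -[primes _]/[:: 2; 3] !inE (negPf p2) /= => /eqP->.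
by move: k_in; rewrite !inE => /orP[]/eqP->.
Qed.

(** The count must be 8, and then the class size 16 is a prime power. *)
Lemma small_size_7 n e : n * e \in small_sizes -> n = 1 %[mod 7] -> 1 < n -> 1 < e -> False.
Proof.
move=> ne n7 n1 e1; have le_n : n <= 11.
  have : n * e <= 22 by move: ne; rewrite !inE => /or4P[||| /or4P[||| /or3P[]]] /eqP->.
  by nia.
have le_e : e <= 11.
  have : n * e <= 22 by move: ne; rewrite !inE => /or4P[||| /or4P[||| /or3P[]]] /eqP->.
  by nia.
have nE : n = 8 by clear -n7 n1 le_n; lia.
rewrite nE in ne; clear -ne e1; move: ne; rewrite !inE; lia.
Qed.

(** The count is 6 or 11, and the odd part 15 of the order excludes the divisors 11 and 9. *)
Lemma small_size_5 n e a : n * e \in small_sizes -> n = 1 %[mod 5] -> 1 < n -> 1 < e ->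
  n * e %| 15 * 2 ^ a -> n = 6 /\ e = 2.
Proof.
move=> ne n5 n1 e1 ne_dvd; have le_ne : n * e <= 22.
  by move: ne; rewrite !inE => /or4P[||| /or4P[||| /or3P[]]] /eqP->.
have le_n : n <= 11 by nia.
have le_e : e <= 11 by nia.
have odd_dvd d : odd d -> d %| n * e -> d %| 15.
  move=> odd_d /dvdn_trans/(_ ne_dvd).
  by rewrite Gauss_dvdl // coprimeXr // coprime_sym coprime2n.
have [nE | nE] : n = 6 \/ n = 11.
  by clear -n5 n1 le_n; lia.
  have e3 : e <> 3 by move=> eE; have := odd_dvd 9 isT; rewrite nE eE => /(_ isT).
  by split=> //; move: e3 e1 le_ne; rewrite nE; clear; case: e => [|[|[|[|e]]]] // _ _; lia.
by have := odd_dvd 11 isT; rewrite nE dvdn_mulr // => /(_ isT).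
Qed.

Lemma muln_eq15 n m : n * m = 15 -> 1 < n -> 1 < m -> n != 3 -> n = 5.
Proof.
move=> nm n1 m1 n3; have : n \in divisors 15 by rewrite -dvdn_divisors // -nm dvdn_mulr.
rewrite -[divisors 15]/[:: 1; 3; 5; 15] !inE (negPf n3) gtn_eqF //= => /orP[/eqP //|].
by move=> /eqP nE; rewrite nE in nm; lia.
Qed.

End ClassSizes.

(** * Transfer in perfect groups *)

Section Nonsolvable.

Local Open Scope nat_scope.
Local Open Scope group_scope.

(** A perfect group has trivial transfer into an abelian group, but on an unfused [x] the transfer
    is a power with exponent prime to [p]. *)
Lemma perfect_fusion (gT : finGroupType) (G P : {group gT}) (p : nat) (x : gT) :
  G^`(1) = G -> p.-Sylow(G) P -> abelian P -> x \in P ->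
  (forall k g, g \in G -> (x ^+ k) ^ g \in P -> (x ^+ k) ^ g = x ^+ k) -> x = 1.
Proof.
move=> perfG sylP abP Px fus; have [sPG pP p'i] := and3P sylP.
have [f [fGP fE]] := transfer_expg sPG abP.
have Gx := subsetP sPG x Px.
have fx1 : f x = 1.
  have : f x \in f @* G^`(1) by rewrite mem_morphim // perfG.
  rewrite morphim_der // (derG1P _) ?inE; first by move/eqP.
  exact: abelianS fGP abP.
have xm1 : x ^+ #|G : P| = 1 by rewrite -fE.
have co_x : coprime #[x] #|G : P|.
  by apply: (@pnat_coprime p); first exact: mem_p_elt Px.
apply/eqP; rewrite -order_eq1 -dvdn1 -(eqnP co_x) dvdn_gcd dvdnn.
by rewrite order_dvdn xm1 eqxx.
Qed.

(** Burnside's transfer theorem: fusion in an abelian Sylow subgroup is realized by its normalizer,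
    so a normalizer centralizing [P] leaves no fusion at all. *)
Lemma abelian_Sylow_norm (gT : finGroupType) (G P : {group gT}) (p : nat) :
  G^`(1) = G -> p.-Sylow(G) P -> abelian P -> P :!=: 1 -> ~~ ('N_G(P) \subset 'C(P)).
Proof.
move=> perfG sylP abP /trivgPn[x Px nt_x]; apply: contra nt_x => sNC.
have sPG := pHall_sub sylP.
rewrite (perfect_fusion perfG sylP abP Px) // => k g Gg.
set y := x ^+ k; have Py : y \in P by rewrite groupX.
move=> Pyg; have sylC (Q : {group gT}) : p.-Sylow(G) Q -> abelian Q -> y ^ g \in Q ->
    p.-Sylow('C_G[y ^ g]) Q.
  move=> sylQ abQ Qyg; apply: (pHall_subl _ (subsetIl _ _) sylQ).
  by rewrite subsetI (pHall_sub sylQ) sub_cent1 (subsetP abQ).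
have sylPg : p.-Sylow('C_G[y ^ g]) (P :^ g).
  by apply: sylC; rewrite ?pHallJ ?abelianJ ?memJ_conjg.
(* [P] and [P :^ g] are abelian and contain [y ^ g], so both are Sylow subgroups of its centralizer
   and are conjugate there. *)
have [c /setIP[Gc cc] PgE] := Sylow_trans (sylC P sylP abP Pyg) sylPg.
have Ngc : g * c^-1 \in 'N_G(P).
  by rewrite inE groupM ?groupV //= inE conjsgM PgE conjsgK.
have /centP/(_ y Py) cy := subsetP sNC _ Ngc.
have : y ^ (g * c^-1) = y by apply/conjg_fixP/commgP.
move=> {2}<-; rewrite conjgM.
apply/esym/conjg_fixP/commgP/commuteV; have /cent1P := cc; first [exact | exact: commute_sym].
Qed.

Lemma card_perfect_abelian_Sylow_center (gT : finGroupType) (G P : {group gT}) (p : nat) :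
  G^`(1) = G -> p.-Sylow(G) P -> abelian P -> P :&: 'Z(G) = 1.
Proof.
move=> perfG sylP abP; apply/trivgP/subsetP=> x /setIP[Px /centerP[Gx cx]].
rewrite inE (perfect_fusion perfG sylP abP Px) // => k g Gg _.
by apply/conjg_fixP/commgP/commute_sym/commuteX/commute_sym/cx.
Qed.

Lemma simple_class_size (gT : finGroupType) (G : {group gT}) (x : gT) :
  simple G -> ~~ abelian G -> x \in G -> x != 1 -> #|x ^: G| <= 23 ->
  #|x ^: G| \in small_sizes.
Proof.
move=> simpleG nabG Gx nt_x.
have : size (primes #|x ^: G|) > 1.
  by apply: primes_class_simple_gt1 simpleG nabG _; rewrite !inE classG_eq1 nt_x mem_classes.
have: all (fun n => (size (primes n) > 1) ==> (n \in small_sizes)) (iota 0 24) by [].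
move=> /allP/(_ #|x ^: G|); rewrite mem_iota add0n ltnS => H sz /H.
by rewrite sz.
Qed.

Lemma simple_index_embed (gT : finGroupType) (S H : {group gT}) (n : nat) :
  simple S -> H \proper S -> #|S : H| = n -> exists f : {morphism S >-> 'S_n}, 'injm f.
Proof.
move=> /simpleP[_ minS] /andP[sHS nSH] iH.
have actR : [acts S, on rcosets H S | 'Rs] by apply: actsRs_rcosets.
have [f [e [inj_e im_e fE]]] := action_perm (subsetT S) actR iH.
exists f; have [/= k1 | /= kS] := minS _ (ker_normal f); first by rewrite k1.
case/negP: nSH; apply/subsetP=> x Sx.
have kx : x \in 'ker f by rewrite kS.
have : gval H \in rcosets H S by apply/rcosetsP; exists 1; rewrite ?rcoset1.
rewrite -im_e => /imsetP[i _ HE].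
have := fE x Sx i; rewrite (mker kx) perm1 -HE /= rcosetE => ->.
exact: rcoset_refl.
Qed.

Lemma perfect_sub_Alt (gT : finGroupType) (G : {group gT}) (n : nat)
    (f : {morphism G >-> 'S_n}) :
  1 < n -> G^`(1) = G -> f @* G \subset 'Alt_('I_n).
Proof.
move=> n1 perfG; have <- : (f @* G)^`(1) = f @* G by rewrite -morphim_der // perfG.
apply: subset_trans (dergS 1 (subsetT _)) _; apply: der1_min; first exact: Alt_norm.
apply/cyclic_abelian/prime_cyclic.
by rewrite card_quotient ?Alt_norm // Alt_index ?card_ord.
Qed.

(** * Simple groups with class sizes at most 23 *)

Section SimpleSmallClasses.

Variables (gT : finGroupType) (S : {group gT}).
Hypotheses (simpleS : simple S) (nabS : ~~ abelian S).
Hypothesis clS : {in S, forall x, #|x ^: S| <= 23}.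

Let sizeS x : x \in S -> x != 1 -> #|x ^: S| \in small_sizes.
Proof. by move=> Sx nt_x; apply: simple_class_size; rewrite ?clS. Qed.

Let perfS : S^`(1) = S.
Proof.
have [_ minS] := simpleP _ simpleS.
by have [/derG1P|//] := minS _ (der_normal 1 S); rewrite (negPf nabS).
Qed.

Let minS (N : {group gT}) : N <| S -> N :=: 1 \/ N :=: S.
Proof. by have [_ minS] := simpleP _ simpleS; apply: minS. Qed.

Let ntS : S :!=: 1. Proof. by have [] := simpleP _ simpleS. Qed.

Let centralElt p : p %| #|S| -> prime p ->
  exists x, [/\ x \in S, #[x] = p & ~~ (p %| #|x ^: S|)].
Proof.
move=> p_dvd p_pr; have [P sylP] := Sylow_exists p S; have [sPS pP p'i] := and3P sylP.
have ntP : P :!=: 1.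
  by rewrite -cardG_gt1 (card_Hall sylP) p_part_gt1 mem_primes p_pr cardG_gt0.
have ntZ : 'Z(P) != 1 by rewrite center_nil_eq1 ?(pgroup_nil pP).
have pZ : p.-group 'Z(P) by apply: pgroupS pP; apply: center_sub.
have [_ p_dvdZ _] := pgroup_pdiv pZ ntZ.
have [x Zx ox] := Cauchy p_pr p_dvdZ.
have [Px cPx] := setIP Zx; have Sx := subsetP sPS x Px.
exists x; split=> //; rewrite -index_cent1 -prime_coprime // coprime_sym.
apply: (@p'nat_coprime p); last by rewrite pnat_id.
by apply: pnat_dvd p'i; rewrite indexgS // subsetI sPS sub_cent1.
Qed.

(** In odd order all nontrivial class sizes would be 15 or 21, thus divisible by 3, against an
    element of order 3 central in a Sylow 3-subgroup. *)
Lemma simple_central_involution : exists t, [/\ t \in S, #[t] = 2 & #|t ^: S| \in [:: 15; 21]%N].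
Proof.
have dvd_cl x : #|x ^: S| %| #|S| by rewrite -index_cent1 dvdn_indexg.
have odd_sz x : x \in S -> x != 1 -> ~~ (2 %| #|x ^: S|) -> #|x ^: S| \in [:: 15; 21]%N.
  move=> Sx nt_x; move: (sizeS Sx nt_x); rewrite !inE.
  by do ![case: eqP => [-> //|_] /=].
have nt_ord (x : gT) p : prime p -> #[x] = p -> x != 1.
  by move=> p_pr ox; rewrite -order_gt1 ox prime_gt1.
have [even_S | odd_S] := boolP (2 %| #|S|).
  have [t [St ot cl_t]] := centralElt even_S isT.
  by exists t; split=> //; apply: odd_sz => //; apply: nt_ord ot.
have odd_cl x : ~~ (2 %| #|x ^: S|) by apply: contra odd_S => /dvdn_trans->.
have [x Sx nt_x] := trivgPn _ ntS.
have S3 : 3 %| #|S|.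
  by apply: dvdn_trans (dvd_cl x); have := odd_sz x Sx nt_x (odd_cl x); rewrite !inE => /orP[]/eqP->.
have [y [Sy oy]] := centralElt S3 isT.
have := odd_sz y Sy (nt_ord y 3 isT oy) (odd_cl y).
by rewrite !inE => /orP[]/eqP->.
Qed.

Lemma cent1_coprimeM (t w : gT) : commute t w -> coprime #[t] #[w] ->
  'C[t * w] = 'C[t] :&: 'C[w].
Proof.
move=> ctw co; apply/eqP; rewrite eqEsubset; apply/andP; split; last first.
  apply/subsetP=> x /setIP[/cent1P ct /cent1P cw]; apply/cent1P.
  exact: commuteM.
have gen (u v : gT) : commute u v -> coprime #[u] #[v] -> <[u]> \subset <[u * v]>.
  move=> cuv co'; have /eqP-> : generator <[u]> (u ^+ #[v]) by rewrite generator_coprime.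
  by rewrite cycle_subG -[u ^+ _]mulg1 -(expg_order v) -expgMn // mem_cycle.
rewrite subsetI -!cent_cycle !centS ?gen //.
by rewrite ctw gen // coprime_sym.
Qed.

(** The class size of [t * w] is a multiple of 15 or 21 not exceeding 23, so [t * w] has the same
    centralizer as [t], which then centralizes [w]. Hence the class size of [w] divides that of [t],
    and no proper divisor of 15 or 21 is admissible. *)
Lemma cent_odd_elt (t w : gT) : t \in S -> #[t] = 2 -> #|t ^: S| \in [:: 15; 21]%N ->
  w \in 'C_S[t] -> odd #[w] -> w != 1 -> 'C_S[w] = 'C_S[t].
Proof.
move=> St ot cl_t /setIP[Sw cw] odd_w nt_w.
have ctw : commute t w by apply/cent1P; rewrite cent1C in cw *.
have co : coprime #[t] #[w] by rewrite ot coprime2n.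
have Stw : t * w \in S by rewrite groupM.
have sCtw : 'C_S[t * w] \subset 'C_S[t] by rewrite setIS // cent1_coprimeM ?subsetIl.
have sCtC : 'C_S[t] \subset 'C_S[t * w].
  have := clS Stw; rewrite -index_cent1 -(Lagrange_index (subsetIl S _) sCtw).
  rewrite -indexg_eq1.
  by rewrite index_cent1 => /(small_size_bounds cl_t (indexg_gt0 _ _))->.
have sCtw' : 'C_S[t] \subset 'C_S[w].
  by apply: subset_trans sCtC _; rewrite setIS // cent1_coprimeM ?subsetIr.
apply/eqP; rewrite eqEsubset sCtw' andbT -indexg_eq1.
have := Lagrange_index (subsetIl S 'C[w]) sCtw'.
by rewrite !index_cent1 => /(small_size_odd (sizeS Sw nt_w) cl_t)->.
Qed.

Lemma simple_no_normal_Sylow p (P : {group gT}) :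
  p.-Sylow(S) P -> P :!=: 1 -> abelian P -> 1 < #|S : 'N_S(P)|.
Proof.
move=> sylP ntP abP; rewrite ltn_neqAle eq_sym indexg_gt0 andbT indexg_eq1.
apply/negP; rewrite subsetI subxx /= => nPS.
have nsPS : P <| S by rewrite /normal (pHall_sub sylP).
case: (minS nsPS) => PE; first by rewrite PE eqxx in ntP.
by have := nabS; rewrite -PE abP.
Qed.

(** If an odd prime [p] divides the order of ['C_S[t]], then all nontrivial p-elements in it share
    this centralizer, so a Sylow p-subgroup [P] is abelian with centralizer ['C_S[t]]. Factoring the
    class size of [t] through the normalizer of [P], [Sylow_count_odd] makes [p] divide an index
    prime to [p]. *)
Lemma cent_involution_2group (t : gT) : t \in S -> #[t] = 2 ->
  #|t ^: S| \in [:: 15; 21]%N -> 2.-group 'C_S[t].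
Proof.
move=> St ot cl_t; apply/pgroupP=> p p_pr p_dvd; apply/idPn=> p2.
have odd_p : odd p by have [p2'|//] := even_prime p_pr; rewrite p2' in p2.
have [w Cw ow] := Cauchy p_pr p_dvd.
have key x : x \in 'C_S[t] -> p.-elt x -> x != 1 -> 'C_S[x] = 'C_S[t].
  move=> Cx px nt_x; apply: cent_odd_elt => //.
  have [n ->] := p_natP px; by rewrite oddX odd_p orbT.
have pw : p.-elt w by rewrite /p_elt ow pnat_id.
have nt_w : w != 1 by rewrite -order_gt1 ow prime_gt1.
have Cw_eq := key w Cw pw nt_w.
have Sw : w \in S by case/setIP: Cw.
have sWS : <[w]> \subset S by rewrite cycle_subG.
have [P sylP sWP] := Sylow_superset sWS pw.
have [sPS pP p'i] := and3P sylP.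
have ntP : P :!=: 1 by apply/trivgPn; exists w; rewrite // -cycle_subG.
(* A central [v] of [P] commutes with [w], so it lies in ['C_S[t]]; having the same centralizer as
   [t], it brings all of [P] into ['C_S[t]]. *)
have /trivgPn[v /setIP[Pv cPv] nt_v] : 'Z(P) != 1 by rewrite center_nil_eq1 ?(pgroup_nil pP).
have Sv := subsetP sPS v Pv.
have Cv : v \in 'C_S[t].
  by rewrite -Cw_eq; apply/setIP; split=> //; rewrite cent1C (subsetP _ _ (_ : w \in P)) // -?cycle_subG // sub_cent1.
have Cv_eq := key v Cv (mem_p_elt pP Pv) nt_v.
have sPC : P \subset 'C_S[t] by rewrite -Cv_eq subsetI sPS sub_cent1.
have keyP x : x \in P -> x != 1 -> 'C_S[x] = 'C_S[t].
  by move=> Px; apply: key; rewrite ?(subsetP sPC) ?(mem_p_elt pP).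
have abP : abelian P.
  apply/centsP=> x Px y Py; have [-> | nt_x] := eqVneq x 1; first exact/commute_sym/commute1.
  have : y \in 'C_S[x] by rewrite keyP // (subsetP sPC).
  by case/setIP=> _ /cent1P/commute_sym.
have CP : 'C_S(P) = 'C_S[t].
  apply/eqP; rewrite eqEsubset; apply/andP; split.
    by rewrite -Cv_eq setIS // -cent_set1 centS // sub1set.
  rewrite subsetI subsetIl centsC; apply/centsP=> x Px c Cc.
  have [-> | nt_x] := eqVneq x 1; first exact/commute_sym/commute1.
  have : c \in 'C_S[x] by rewrite keyP.
  by case/setIP=> _ /cent1P/commute_sym.
have sCN : 'C_S[t] \subset 'N_S(P) by rewrite -CP setIS // cent_sub.
have eq_k := Lagrange_index (subsetIl S 'N(P)) sCN; rewrite index_cent1 in eq_k.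
have sCcP : 'C_S[t] \subset 'C(P) by rewrite -CP subsetIr.
have m1 : 1 < #|'N_S(P) : 'C_S[t]|.
  rewrite ltn_neqAle eq_sym indexg_gt0 andbT indexg_eq1.
  apply: contra (abelian_Sylow_norm perfS sylP abP ntP) => sNC.
  exact: subset_trans sNC sCcP.
have nmod : #|S : 'N_S(P)| = 1 %[mod p] by rewrite -(card_Syl sylP) card_Syl_mod // modn_small ?prime_gt1.
have := Sylow_count_odd cl_t eq_k (simple_no_normal_Sylow sylP ntP abP) m1 p_pr p2 nmod.
apply/negP; rewrite -p'natE // -index_cent1.
by apply: pnat_dvd p'i; rewrite indexgS.
Qed.

(** A generator of [P] has the same centralizer as [P], so its class size is the number of Sylow
    p-subgroups times the index of this centralizer in the normalizer, which exceeds 1 by Burnside's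
    transfer theorem. *)
Lemma cyclic_Sylow_class p (P : {group gT}) : prime p -> p.-Sylow(S) P -> #|P| = p ->
  exists n m, [/\ n = #|S : 'N_S(P)|, n * m \in small_sizes, n = 1 %[mod p], 1 < n & 1 < m]%N
     /\ (n * m %| #|S|)%N.
Proof.
move=> p_pr sylP cP; have sPS := pHall_sub sylP.
have ntP : P :!=: 1 by rewrite -cardG_gt1 cP prime_gt1.
have [z Pz nt_z] := trivgPn _ ntP; have Sz := subsetP sPS z Pz.
have PE : P :=: <[z]>.
  apply/eqP; rewrite eq_sym eqEcard cycle_subG Pz cP -orderE.
  by rewrite dvdn_leq // ?order_gt0 //; have := order_dvdG Pz; rewrite cP => /(primeP p_pr).2/pred2P[/eqP|->] //; rewrite order_eq1 (negPf nt_z).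
have abP : abelian P by rewrite PE cycle_abelian.
have CP : 'C_S(P) = 'C_S[z] by rewrite PE cent_cycle.
have sCN : 'C_S[z] \subset 'N_S(P) by rewrite -CP setIS // cent_sub.
have sCcP : 'C_S[z] \subset 'C(P) by rewrite -CP subsetIr.
exists #|S : 'N_S(P)|, #|'N_S(P) : 'C_S[z]|.
rewrite (Lagrange_index (subsetIl S _) sCN) index_cent1; split; last first.
  by rewrite -index_cent1 dvdn_indexg.
split=> //; first exact: sizeS.
- by rewrite -(card_Syl sylP) card_Syl_mod // modn_small ?prime_gt1.
- exact: simple_no_normal_Sylow sylP ntP abP.
rewrite ltn_neqAle eq_sym indexg_gt0 andbT indexg_eq1.
apply: contra (abelian_Sylow_norm perfS sylP abP ntP) => sNC.
exact: subset_trans sNC sCcP.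
Qed.

Lemma card_Alt6 : #|'Alt_('I_6)| = 360.
Proof. by apply/eqP; rewrite -(@eqn_pmul2l 2) // card_Alt card_ord. Qed.

(** The order is 15 or 21 times a power of 2. Counting Sylow 7-subgroups excludes 21; the six Sylow
    5-subgroups embed [S] into Alt(6), which bounds the power of 2. *)
Lemma card_simple_small_classes : exists t,
  [/\ #|S| = 60, t \in S, #[t] = 2, #|t ^: S| = 15 & #|'C_S[t]| = 4]%N.
Proof.
have [t [St ot cl_t]] := simple_central_involution.
have pC := cent_involution_2group St ot cl_t.
have [a cC] := p_natP pC.
have cS : #|S| = (2 ^ a * #|t ^: S|)%N by rewrite -cC -index_cent1 Lagrange ?subsetIl.
have sylP p : prime p -> p != 2 -> logn p #|t ^: S| = 1%N ->
    exists2 P : {group gT}, p.-Sylow(S) P & #|P| = p.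
  move=> p_pr p2 lp; have [P sylP] := Sylow_exists p S; exists P => //.
  rewrite (card_Hall sylP) p_part cS lognM ?expn_gt0 ?lp //; last by rewrite -index_cent1.
  by rewrite lognX (@logn_prime p 2 isT) (negPf p2) muln0.
have cl15 : #|t ^: S| = 15.
  move: cl_t; rewrite !inE => /orP[/eqP// | /eqP cl21].
  have [|P syl7 c7] := sylP 7 isT isT; first by rewrite cl21.
  have [n [m [[_ nm n7 n1 m1] _]]] := cyclic_Sylow_class (isT : prime 7) syl7 c7.
  by case: (small_size_7 nm n7 n1 m1).
exists t; rewrite cC cl15 in cS *.
have [|P syl5 c5] := sylP 5 isT isT; first by rewrite cl15.
have [n [m [[nE nm n5 n1 m1]]]] := cyclic_Sylow_class (isT : prime 5) syl5 c5.
rewrite cS [X in _ %| X]mulnC => nm_dvd; have [n6 m2] := small_size_5 nm n5 n1 m1 nm_dvd.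
have prN : 'N_S(P) \proper S.
  rewrite properEneq subsetIl andbT; apply: contraTneq n1 => NE.
  by rewrite nE NE indexgg.
have [f injf] := simple_index_embed simpleS prN (esym (etrans (esym n6) nE)).
have fS_Alt : f @* S \subset 'Alt_('I_6) by apply: perfect_sub_Alt.
have cfS : #|f @* S| = #|S| by apply: card_injm.
have a_le3 : a <= 3.
  have : #|S| %| 360 by rewrite -card_Alt6 -cfS cardSg.
  by rewrite cS -[360]/((24 * 15)%N) dvdn_pmul2r // pfactor_dvdn.
have a_ge2 : 1 < a.
  rewrite -(@dvdn_Pexp2l 2) // -(@Gauss_dvdr _ 15) //.
  by apply: dvdn_trans nm_dvd; rewrite n6 m2.
have a2 : a = 2.
  apply/eqP; rewrite eqn_leq a_ge2 andbT -ltnS ltn_neqAle a_le3 andbT.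
  (* Order 120 would be index 3 in Alt(6), embedding Alt(6) into Sym(3). *)
  apply/eqP=> a3; rewrite a3 in cS.
  have iA : #|'Alt_('I_6) : f @* S| = 3.
    by apply/eqP; rewrite -(@eqn_pmul2l 120) // -[X in (X * _)%N]cS -cfS Lagrange ?card_Alt6.
  have prA : [group of f @* S] \proper 'Alt_('I_6).
    by rewrite properEcard fS_Alt card_Alt6 /= cfS cS.
  have simA : simple 'Alt_('I_6) by rewrite simple_Alt5 ?card_ord.
  have [g injg] := simple_index_embed simA prA iA.
  have := subset_leq_card (subsetT (g @* 'Alt_('I_6))).
  rewrite (card_injm injg (subxx _)) card_Alt6; apply/negP; rewrite -ltnNge.
  by have := card_Sym 'I_3; rewrite card_ord => ->.
by rewrite a2 in cS *; split.
Qed.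

(** A Sylow 2-subgroup has order 4 and index 15, and 15 is its own only admissible divisor as a
    class size. Its normalizer has index 3 or 5, and index 3 would embed [S] into Sym(3). *)
Lemma simple_small_classes_Sylow2 :
  [/\ #|S| = 60%N, #|'Syl_2(S)| = 5%N & forall T : {group gT}, 2.-Sylow(S) T ->
     abelian T /\ {in T, forall x, x != 1 -> #|x ^: S| = 15%N}].
Proof.
have [t [cS St ot cl_t cC]] := card_simple_small_classes.
have c60 : (60`_2)%N = 4 by rewrite p_part.
have sylT0 : 2.-Sylow(S) 'C_S[t].
  by rewrite pHallE subsetIl cC cS c60.
have abT (T : {group gT}) : 2.-Sylow(S) T -> abelian T.
  move=> sylT; apply: (@p2group_abelian _ 2); first exact: pHall_pgroup sylT.
  by rewrite (card_Hall sylT) cS c60.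
split=> // [|T sylT]; last first.
  split=> [|x Tx nt_x]; first exact: abT.
  have Sx := subsetP (pHall_sub sylT) x Tx.
  have dvd15 : #|x ^: S| %| 15.
    have sTC : T \subset 'C_S[x].
      by rewrite subsetI (pHall_sub sylT) sub_cent1 (subsetP (abT T sylT)).
    have -> : 15 = #|S : T|.
      by apply/eqP; rewrite -(@eqn_pmul2l #|T|) ?cardG_gt0 // Lagrange ?(pHall_sub sylT) // (card_Hall sylT) cS c60.
    by rewrite -index_cent1 indexgS.
  have := sizeS Sx nt_x.
  have : #|x ^: S| \in divisors 15 by rewrite -dvdn_divisors.
  by rewrite -[divisors 15]/[:: 1; 3; 5; 15]%N !inE => /or4P[]/eqP->.
have ntT : 'C_S[t] != 1 by rewrite -cardG_gt1 cC.
have abT0 := abT [group of 'C_S[t]] sylT0.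
have sTN : 'C_S[t] \subset 'N_S('C_S[t]) by rewrite subsetI subsetIl normG.
have n1 := simple_no_normal_Sylow (P := [group of 'C_S[t]]) sylT0 ntT abT0.
have m1 : 1 < #|'N_S('C_S[t]) : 'C_S[t]|.
  rewrite ltn_neqAle eq_sym indexg_gt0 andbT indexg_eq1.
  apply: contra (abelian_Sylow_norm perfS sylT0 abT0 ntT) => sNC.
  exact: subset_trans sNC abT0.
have nm := Lagrange_index (subsetIl S 'N('C_S[t])) sTN; rewrite index_cent1 cl_t in nm.
have n3 : #|S : 'N_S('C_S[t])| != 3.
  apply/eqP=> n3; have prN : 'N_S('C_S[t]) \proper S.
    by rewrite properEneq subsetIl andbT; apply: contraTneq isT => NE; rewrite NE indexgg in n3.
  have [f injf] := simple_index_embed simpleS prN n3.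
  have := subset_leq_card (subsetT (f @* S)).
  rewrite (card_injm injf (subxx _)) cS; apply/negP; rewrite -ltnNge.
  by have := card_Sym 'I_3; rewrite card_ord => ->.
by rewrite (card_Syl sylT0); apply: muln_eq15 nm n1 m1 n3.
Qed.

End SimpleSmallClasses.

(** * Perfect groups with class sizes at most 23 *)

Lemma dvdn_morphim_class (gT rT : finGroupType) (G : {group gT})
    (f : {morphism G >-> rT}) (x : gT) :
  x \in G -> #|f x ^: (f @* G)| %| #|x ^: G|.
Proof.
move=> Gx; rewrite -!index_cent1.
rewrite -(index_morphim_ker f (subsetIl G 'C[x]) (subxx G)) dvdn_mulr //.
apply: indexgS; rewrite subsetI morphimS ?subsetIl //=.
apply/subsetP=> _ /morphimP[y Gy /setIP[_ /cent1P cxy] ->].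
by apply/cent1P; rewrite /commute -!morphM ?cxy.
Qed.

Lemma cyclic_ker_central_abelian (gT rT : finGroupType) (G P : {group gT})
    (f : {morphism G >-> rT}) :
  P \subset G -> (forall z x, z \in P -> f z = 1 -> x \in P -> commute z x) ->
  cyclic (f @* P) -> abelian P.
Proof.
move=> sPM Pcentral cycP.
have [c fP] := cyclicP cycP.
have [a Pa fa] : exists2 a, a \in P & f a = c.
  have : c \in f @* P by rewrite fP cycle_id.
  by case/morphimP=> a _ Pa ->; exists a.
have Ma := subsetP sPM a Pa.
have dec x : x \in P -> exists i z, [/\ z \in P, f z = 1 & x = a ^+ i * z].
  move=> Px; have : f x \in f @* P by rewrite mem_morphim ?(subsetP sPM).
  rewrite fP => /cycleP[i fx]; exists i, ((a ^+ i)^-1 * x).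
  rewrite groupM ?groupV ?groupX // morphM ?groupV ?groupX ?(subsetP sPM) //.
  by rewrite morphV ?groupX // morphX // fa -fx mulVg mulKVg.
apply/centsP=> x /dec[i [z [Pz fz ->]]] y' /dec[j [z' [Pz' fz' ->]]].
apply: commuteM; apply/commute_sym; apply: commuteM.
- by apply/commute_sym/commuteX2.
- by apply/commute_sym/Pcentral => //; apply: groupX.
- by apply: Pcentral => //; apply: groupX.
by apply: Pcentral.
Qed.

(** Above a class of size 15 in the quotient only size 15 is possible, since 30 exceeds 23, so
    commutation with its elements lifts. This makes [K] central, and transfer into abelian Sylow
    subgroups makes it trivial. Covers such as SL(2,5), which has a class of size 30, are excluded
    here. *)
Lemma perfect_small_classes_simple (gT : finGroupType) (M : {group gT}) :
  M :!=: 1 -> M^`(1) = M -> {in M, forall x, #|x ^: M| <= 23} -> simple M.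
Proof.
move=> ntM perfM clM.
have [K maxK] := ex_maxnormal_ntrivg ntM.
have nsKM := maxnormal_normal maxK; have [sKM nKM] := andP nsKM.
have simS : simple (M / K) by rewrite quotient_simple.
have perfS : (M / K)^`(1) = M / K by rewrite -quotient_der ?perfM.
have nabS : ~~ abelian (M / K).
  by have [ntS _] := simpleP _ simS; apply: contra ntS => /derG1P; rewrite perfS => MK1; apply/eqP.
pose f := restrm_morphism nKM (coset_morphism K).
have fM : f @* M = M / K by rewrite morphim_restrm setIid.
have kerf : 'ker f = K by rewrite ker_restrm ker_coset; apply/setIidPr.
have clS : {in M / K, forall x, #|x ^: (M / K)| <= 23}.
  move=> _ /morphimP[x _ Mx ->]; apply: leq_trans (clM x Mx).
  by rewrite -fM dvdn_leq ?(dvdn_morphim_class f) // -index_cent1.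
have [cS cSyl sylS] := simple_small_classes_Sylow2 simS nabS clS.
have lift g h : g \in M -> h \in M -> #|f g ^: (M / K)| = 15 -> commute (f g) (f h) ->
    commute g h.
  move=> Mg Mh cl15; apply: commute_lift => //.
  have := dvdn_morphim_class f Mg; rewrite fM cl15 => /dvdnP[m mE].
  have := clM g Mg; rewrite mE; case: m {mE} => [|[|m]] //; rewrite !mulSn; lia.
have [t [_ St ot cl_t _]] := card_simple_small_classes simS nabS clS.
have [g Mg fg] : exists2 g, g \in M & f g = t.
  by have /morphimP[g Mg _ ->] : t \in f @* M; [rewrite fM | exists g].
have CK h : h \in M -> #|f h ^: (M / K)| = 15 -> h \in 'C_M(K).
  move=> Mh cl15; rewrite inE Mh; apply/centP=> k Kk.
  apply: lift => //; first exact: (subsetP sKM).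
  have -> : f k = 1 by apply: mker; rewrite kerf.
  exact: commute1.
have sKC : K \subset 'C_M(K).
  apply/subsetP=> k Kk; have Mk := subsetP sKM k Kk.
  have fk : f k = 1 by apply: mker; rewrite kerf.
  (* Both [g] and [g * k] lie above the involution [t], so both centralize [K]. *)
  rewrite -(mulKg g k) groupM ?groupV //.
    by apply: CK => //; rewrite fg.
  by apply: CK; rewrite ?groupM // morphM // fk mulg1 fg.
have CM : 'C_M(K) = M.
  apply/eqP; rewrite eqEsubset subsetIl /=.
  have nsC : 'C_M(K) <| M by rewrite norm_normalI // norms_cent.
  have : f @* 'C_M(K) <| M / K by rewrite -fM morphim_normal.
  have [_ minS] := simpleP _ simS.
  case/(minS [group of f @* 'C_M(K)]) => /= fC.
    have : f g \in f @* 'C_M(K) by rewrite mem_morphim // CK // fg.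
    by rewrite fC inE fg => /eqP t1; move: ot; rewrite t1 order1.
  by rewrite -(morphimSGK _ (_ : 'ker f \subset 'C_M(K))) ?kerf // fM fC.
have sKZ : K \subset 'Z(M).
  by rewrite subsetI sKM centsC -{1}CM subsetIr.
have K1 : K :=: 1.
  apply/eqP; apply/idPn => /trivgPn[y Ky nt_y].
  pose p := pdiv #[y]; have p_pr : prime p by rewrite pdiv_prime ?order_gt1.
  have p_dvd : p %| #|K| by apply: dvdn_trans (order_dvdG Ky); apply: pdiv_dvd.
  have [k Kk ok] := Cauchy p_pr p_dvd.
  have pk : p.-elt k by rewrite /p_elt ok pnat_id.
  have sKkM : <[k]> \subset M by rewrite cycle_subG (subsetP sKM).
  have [P sylP sKP] := Sylow_superset sKkM pk.
  have sPM := pHall_sub sylP.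
  suff abP : abelian P.
    have : k \in P :&: 'Z(M) by rewrite inE -cycle_subG sKP (subsetP sKZ).
    rewrite (card_perfect_abelian_Sylow_center perfM sylP abP) inE => /eqP k1.
    by move: (prime_gt1 p_pr); rewrite -ok k1 order1.
  have sylfP : p.-Sylow(M / K) (f @* P) by rewrite -fM morphim_pHall.
  have Pcentral z x : z \in P -> f z = 1 -> x \in P -> commute z x.
    move=> Pz fz Px; have Mz := subsetP sPM z Pz.
    have : z \in 'Z(M) by rewrite (subsetP sKZ) // -kerf; apply/kerP.
    by case/centerP=> _ /(_ x (subsetP sPM x Px)).
  have [p2 | p_odd] := eqVneq p 2.
    rewrite p2 in sylfP; have [abfP clfP] := sylS [group of f @* P] sylfP.
    apply/centsP=> x Px z Pz; have Mx := subsetP sPM x Px; have Mz := subsetP sPM z Pz.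
    have [fx1 | ntfx] := eqVneq (f x) 1; first exact: Pcentral.
    apply: lift => //; first by apply: clfP; rewrite ?mem_morphim.
    by apply: (centsP abfP); rewrite mem_morphim.
  (* An odd prime divides 60 at most once. *)
  have cycP : cyclic (f @* P).
    have : logn p 60 <= 1.
      have [p60 | p60] := boolP (p \in primes 60); last by rewrite lognE; move: p60; rewrite mem_primes => /negPf->.
      by move: p60; rewrite -[primes 60]/[:: 2; 3; 5]%N !inE (negPf p_odd) /= => /orP[]/eqP->.
    move=> lp; have := card_Hall sylfP; rewrite cS p_part /=.
    case: (logn p 60) lp => [|[|//]] _ cP; last by apply: prime_cyclic; rewrite cP.
    by rewrite (card1_trivg cP) cyclic1.
  exact: cyclic_ker_central_abelian sPM Pcentral cycP.
have K1g : K = 1%G by apply/val_inj.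
by move: simS; rewrite K1g -(isog_simple (quotient1_isog M)).
Qed.

Lemma derived_series_stable (gT : finGroupType) (G : {group gT}) :
  exists n, G^`(n.+1) = G^`(n).
Proof.
case: (boolP [exists n : 'I_#|G|.+1, G^`(n.+1) == G^`(n)]).
  by case/existsP=> n /eqP; exists n.
rewrite negb_exists => /forallP neq.
have : #|G^`(#|G|.+1)| + #|G|.+1 <= #|G|.
  suff H n : n <= #|G|.+1 -> #|G^`(n)| + n <= #|G| by apply: H.
  elim: n => [|n IHn] le_n; first by rewrite addn0.
  apply: leq_trans (IHn (ltnW le_n)); rewrite addnS -addSn leq_add2r.
  by apply: proper_card; rewrite properEneq (neq (Ordinal le_n)) der_subS.
by rewrite addnS ltnNge leq_addl.
Qed.

End Nonsolvable.

(** * From a nonsolvable group to an orbit of length 24 *)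

Section Solvable.

Local Open Scope nat_scope.
Local Open Scope group_scope.

(** Order 5 forces transitivity, so a permutation commuting with [z] is determined by the image of
    one point. *)
Lemma class_order5_S5 (z : 'S_5) : #[z] = 5 -> 24 <= #|z ^: [set: 'S_5]|.
Proof.
move=> oz; have card5 : #|[set: 'S_5]| = 120 by have := card_Sym 'I_5; rewrite card_ord.
suff leC : #|'C_[set: 'S_5][z]| <= 5.
  rewrite -index_cent1 -(leq_pmul2l (isT : 0 < 5)).
  apply: leq_trans (_ : #|'C_[set: 'S_5][z]| * #|[set: 'S_5] : 'C_[set: 'S_5][z]| <= _).
    by rewrite Lagrange ?subsetIl // card5.
  by rewrite leq_mul2r leC orbT.
have [i zi] : exists i, z i != i.
  apply/existsP; apply: contraPT oz; rewrite negb_exists => /forallP z1.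
  have -> : z = 1 by apply/permP=> i; rewrite perm1; apply/eqP; have := z1 i; rewrite negbK.
  by rewrite order1.
have trans j : exists n, j = (z ^+ n) i.
  have := dvdn_orbit 'P%act <[z]> i; rewrite -orderE oz => orb_dvd.
  have n1 : #|orbit 'P%act <[z]> i| != 1%N.
    apply/negP=> /cards1P[k orb1]; case/negP: zi; apply/eqP.
    have : z i \in orbit 'P%act <[z]> i by apply: (mem_orbit 'P%act i (cycle_id z)).
    have : i \in orbit 'P%act <[z]> i by apply: orbit_refl.
    by rewrite orb1 !inE => /eqP-> /eqP.
  have /(_ _ orb_dvd)/pred2P[/eqP|orb5] := (primeP (isT : prime 5)).2; first by rewrite (negPf n1).
  have : j \in orbit 'P%act <[z]> i.
    suff -> : orbit 'P%act <[z]> i = setT by rewrite inE.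
    by apply/eqP; rewrite eqEcard subsetT cardsT card_ord orb5.
  by case/orbitP=> _ /cycleP[n ->] <-; exists n.
rewrite -(card_in_imset (f := fun c : 'S_5 => c i)).
  by apply: leq_trans (max_card _) _; rewrite card_ord.
move=> c d /setIP[_ /cent1P cc] /setIP[_ /cent1P cd] eq_i; apply/permP=> j.
have [n ->] := trans j; rewrite -!permM.
by rewrite -(commuteX n cc) -(commuteX n cd) !permM eq_i.
Qed.

Lemma conj_Aut_lift (gT rT : finGroupType) (G : {group gT})
    (f : {morphism G >-> rT}) (y : rT) :
  'injm f -> y \in 'N(f @* G) ->
  exists2 a, a \in Aut G & {in G, forall x, f (a x) = f x ^ y}.
Proof.
move=> injf nGy.
have fGy x : x \in G -> f x ^ y \in f @* G.
  by move=> Gx; rewrite memJ_norm // mem_morphim.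
pose h x := invm injf (f x ^ y).
have hM : {in G &, {morph h : u v / u * v}}.
  by move=> u v Gu Gv; rewrite /h morphM // conjMg morphM ?fGy.
have fh x : x \in G -> f (h x) = f x ^ y by move=> Gx; rewrite /h invmK ?fGy.
have hG x : x \in G -> h x \in G.
  by move=> Gx; have := mem_morphim (invm injf) (fGy x Gx) (fGy x Gx); rewrite im_invm.
have injh : 'injm (Morphism hM).
  apply/injmP=> u v Gu Gv /(congr1 f); rewrite /= !fh // => /conjg_inj.
  by move/(injmP injf); apply.
have imh : Morphism hM @* G = G.
  apply/eqP; rewrite eqEcard card_injm // leqnn andbT.
  by apply/subsetP=> _ /morphimP[x _ Gx ->]; apply: hG.
exists (aut injh imh); first exact: Aut_aut.
by move=> x Gx; rewrite autE //= fh.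
Qed.

Theorem maol_leq23_solvable (gT : finGroupType) (G : {group gT}) :
  maol G <= 23 -> solvable G.
Proof.
move=> maolG; apply: contraT => nsolG.
have [n Gn] := derived_series_stable G; pose M := [group of G^`(n)].
have chM : M \char G by apply: der_char.
have nsMG : M <| G := char_normal chM.
have [sMG nMG] := andP nsMG.
have ntM : M :!=: 1.
  by apply: contra nsolG => /eqP M1; apply/derivedP; exists n; rewrite /= -[G^`(n)]/(gval M) M1.
have perfM : M^`(1) = M by rewrite -[RHS]Gn.
have clG x : x \in G -> #|x ^: G| <= 23.
  by move=> Gx; rewrite -index_cent1 index_cent1_maol.
have clM : {in M, forall x, #|x ^: M| <= 23}.
  move=> x Mx; apply: leq_trans (clG x (subsetP sMG x Mx)).
  by apply: subset_leq_card; apply: imsetS.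
have simM := perfect_small_classes_simple ntM perfM clM.
have nabM : ~~ abelian M.
  by apply: contra ntM => /derG1P; rewrite perfM => ->.
have [cM cSyl _] := simple_small_classes_Sylow2 simM nabM clM.
have actG : [acts G, on 'Syl_2(M) | 'JG].
  apply/subsetP=> g Gg; rewrite !inE; apply/subsetP=> P; rewrite !inE /=.
  by rewrite pHallJnorm // (subsetP nMG).
have [f [e [inje imE fE]]] := action_perm (subsetT G) actG cSyl.
(* Otherwise [M] normalizes all its Sylow 2-subgroups; being conjugate in [M], they would
   coincide. *)
have kerM : M :&: 'ker f = 1.
  have /simpleP[_ /(_ (M :&: 'ker f)%G)] := simM.
  case=> [|//|MkerM]; first by rewrite /normal subsetIl normsI ?normG // (subset_trans sMG) // ker_norm.
  have {}MkerM : M \subset 'ker f by apply/setIidPl.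
  have fixSyl (Q : {group gT}) g : Q \in 'Syl_2(M) -> g \in M -> Q :^ g = Q.
    rewrite -imE => /imsetP[i _ ->] Mg.
    have := congr1 val (fE g (subsetP sMG g Mg) i) => /= <-.
    by have /mker-> := subsetP MkerM g Mg; rewrite perm1.
  have [P sylP] := Sylow_exists 2 M.
  suff : #|'Syl_2(M)| <= 1 by rewrite cSyl.
  rewrite -[X in _ <= X](cards1 P); apply/subset_leq_card/subsetP=> Q; rewrite !inE => sylQ.
  have [g Mg QE] := Sylow_trans sylP sylQ.
  by rewrite -val_eqE /= QE fixSyl // inE.
have injfM : 'injm (restrm sMG f).
  by rewrite ker_restrm kerM.
have oM (x : gT) : x \in M -> #[f x] = #[x] by move=> Mx; rewrite -(order_injm injfM Mx).
have fM : f @* M = 'Alt_('I_5).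
  have := perfect_sub_Alt (restrm_morphism sMG f) isT perfM.
  rewrite morphim_restrm setIid => sMA; apply/eqP; rewrite eqEcard sMA /=.
  have := card_injm injfM (subxx M); rewrite morphim_restrm setIid => ->.
  rewrite cM -(leq_pmul2l (isT : 0 < 2)).
  have := @card_Alt 'I_5; rewrite card_ord => ->//.
have [z Mz oz] : exists2 z, z \in M & #[z] = 5.
  have p5 : 5 %| #|M| by rewrite cM.
  by have [z Mz oz] := Cauchy (isT : prime 5) p5; exists z.
have Gz := subsetP sMG z Mz.
have ofz : #[f z] = 5.
  by rewrite oM.
pose F g := (f g, coset M g).
have FM : {in G &, {morph F : u v / u * v}}.
  by move=> u v Gu Gv; rewrite /F !morphM // (subsetP nMG).
have FE g : g \in G -> Morphism FM g = (f g, coset M g) by [].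
have injF : 'injm (Morphism FM).
  apply/subsetP=> g /morphpreP[Gg /set1P[fg1 /coset_idr]].
  move=> /(_ (subsetP nMG g Gg)) Mg.
  by rewrite -kerM inE Mg; apply/kerP.
(* [[~ f g, s]] is even, hence the image of some [m] in [M]; replacing [g] by [g * m] conjugates the
   first component by [s] and keeps the second. *)
have nF (s : 'S_5) : (s, 1) \in 'N(Morphism FM @* G).
  rewrite inE; apply/subsetP=> _ /imsetP[_ /morphimP[g _ Gg ->] ->].
  have : [~ f g, s] \in f @* M.
    by rewrite fM Alt_even commgEl odd_permM odd_permV odd_permJ addbb.
  case/morphimP=> m _ Mm fm; have Gm := subsetP sMG m Mm.
  apply/morphimP; exists (g * m); rewrite ?groupM //.
  have Ng := subsetP nMG g Gg.
  have fgm : f (g * m) = f g ^ s by rewrite morphM // -fm commgEl mulKVg.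
  have cgm : coset M (g * m) = coset M g by rewrite coset_kerr.
  by rewrite !FE ?groupM // fgm cgm -[coset M g in RHS]conjg1.
have : f z ^: [set: 'S_5] \subset f @: orbit 'P%act (Aut G) z.
  apply/subsetP=> _ /imsetP[s _ ->].
  have [a Aa /(_ z Gz)[Ea _]] := conj_Aut_lift injF (nF s).
  have {}Ea : f (a z) = f z ^ s by [].
  by rewrite -Ea; apply: imset_f; apply: (mem_orbit 'P%act z Aa).
move/subset_leq_card/(leq_trans (class_order5_S5 ofz)).
move=> /leq_trans/(_ (leq_imset_card _ _)).
by rewrite ltnNge (maol_leqP _ _ maolG).
Qed.

End Solvable.

Theorem theorem1p1 :
  [/\ (forall (gT : finGroupType) (G : {group gT}),
         (maol G <= 3)%N <->
         [\/ exists2 m : nat, m \in [:: 1; 2; 3; 4; 6]%N & G \isog Zp m,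
             G \isog [set: 'Z_2 * 'Z_2]
           | G \isog [set: 'S_3]]) /\
      finitely_many_up_to_isog
        (fun (gT : finGroupType) (G : {group gT}) => (maol G <= 3)%N),
      infinitely_many_up_to_isog
        (fun (gT : finGroupType) (G : {group gT}) =>
           (2.-group G)%g /\ maol G = 8%N),
      (forall (R : realType) (c d : nat), (0 < c)%N -> (0 < d)%N ->
         forall (gT : finGroupType) (G : {group gT}),
           d_generated d G -> (maol G <= c)%N ->
           ln (#|G|%:R : R) <=
             (1 + 1624 / 10 ^+ 5) * d%:R * (Abound R c d + 1)
               * (ln (Abound R c d) / ln 2 + 1)
             + 2^-1 * (7 + ln c%:R) * ln c%:R)
    & (forall (gT : finGroupType) (G : {group gT}),
         (maol G <= 23)%N -> solvable G)].
Proof.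
split; first split.
- move=> gT G; split; [exact: maol_leq3_cases | exact: maol_leq3_converse].
- exact: maol_leq3_finite.
- exact: infinite_2groups_maol8.
- move=> R c d c0 d0 gT G dG maolG.
  by apply: ln_bound; rewrite ?cardG_gt0 ?d_generated_card.
- exact: maol_leq23_solvable.
Qed.
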